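(* Let $W$ be a $4$-web with nonconstant basic invariant $a$. Then the curvature forms of its four $3$-subwebs are all equal if and only if all four $3$-subwebs are parallelizable, i.e. $K_{[bcd]}=0$ and $\Theta_{[bcd]}=0$ for every $3$-subweb $[b,c,d]$, and the second covariant derivatives of $a$ are expressed in terms of $a$ and its first covariant derivatives by $$a_{11}=\frac{a_1[(1-2a)a_1+a\,a_2]}{a-a^2},\qquad a_{12}=\frac{a_1a_2}{a},\qquad a_{22}=\frac{a_2(a_1-a\,a_2)}{a-a^2}.$$
   Context: Let $M^2$ be a two-dimensional analytic manifold. A $4$-web $W$ is given in an open connected domain $D\subset M^2$ by four foliations $X_1,X_2,X_3,X_4$ of curves such that the tangents to the curves of different foliations through any point of $D$ are distinct, and two curves of different foliations have at most one common point in $D$. All functions and forms are real of class $C^\infty$ (or holomorphic in the complex case). All considerations are local. The foliation $X_\alpha$, $\alpha=1,2,3$, is defined by $\omega_\alpha=0$, where the $1$-forms are normalized so that $\omega_1+\omega_2+\omega_3=0$. There is a unique $1$-form $\theta$ with $d\omega_\alpha=\omega_\alpha\wedge\theta$, and the curvature $K$ of the $3$-subweb $[1,2,3]$ is defined by $d\theta=K\,\omega_1\wedge\omega_2$. The foliation $X_4$ is defined by $\omega_4=0$, where $-\omega_4=a\omega_1+\omega_2$; the function $a\neq0,1$ is the basic invariant. Covariant derivatives of $a$ are defined by $da=a_1\omega_1+a_2\omega_2$, $da_1-a_1\theta=a_{11}\omega_1+a_{12}\omega_2$, $da_2-a_2\theta=a_{12}\omega_1+a_{22}\omega_2$. ''Nonconstant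 basic invariant'' means that $a_1$ and $a_2$ do not vanish simultaneously. The curvatures and curvature forms of the four $3$-subwebs ($[b,c,d]$ is formed by $X_b,X_c,X_d$) are $$K_{[123]}=K,\qquad K_{[124]}=\frac1a\Bigl(K-\frac{a_{12}}{a}+\frac{a_1a_2}{a^2}\Bigr),$$ $$K_{[134]}=\frac{1}{a-1}\Bigl[K+\frac{a_2(a_1-a_2)}{(1-a)^2}+\frac{a_{12}-a_{22}}{1-a}\Bigr],$$ $$K_{[234]}=\frac{1}{a(a-1)}\Bigl[K+\frac{(2a-1)a_1(a_1-a_2)}{a^2(1-a)^2}+\frac{a_{11}-a_{12}}{a(1-a)}\Bigr],$$ $$\Theta_{[123]}=K\omega_1\wedge\omega_2,\quad \Theta_{[124]}=aK_{[124]}\omega_1\wedge\omega_2,\quad \Theta_{[134]}=(a-1)K_{[134]}\omega_1\wedge\omega_2,\quad \Theta_{[234]}=a(a-1)K_{[234]}\omega_1\wedge\omega_2.$$ A $3$-web is parallelizable if it is equivalent, under a diffeomorphism (respectively an analytic isomorphism) of web domains carrying foliations to foliations, to a web of three foliations of parallel straight lines in an affine plane; this holds (locally) exactly when its curvature vanishes. *)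

(* Defs.v *)
From mathcomp Require Import all_boot all_order all_algebra.
From mathcomp Require Import complex.
From mathcomp Require Import boolp classical_sets functions reals.
From mathcomp Require Import topology normedtype derive.
From Stdlib Require Import Relation_Operators.

Set Implicit Arguments.
Unset Strict Implicit.
Unset Printing Implicit Defensive.

Import Order.TTheory GRing.Theory Num.Theory.
Import numFieldNormedType.Exports.

Local Open Scope classical_set_scope.
Local Open Scope ring_scope.

(* The real C^oo case and the holomorphic case; the same definitions, over the
   scalar field R or R[i], serve for both. *)
Variant category := RealSmooth | Holomorphic.

Definition scalars (R : realType) (c : category) : numFieldType :=
  match c with
  | RealSmooth => R
  | Holomorphic => R[i]
  end.

Section Calculus.
Context {K : numFieldType}.

(* For K = R this is the usual class C^n. For K = R[i] derivatives are complex,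
   so that lying in all these classes means being holomorphic. *)
Fixpoint class_C (n : nat) {V W : normedModType K} (A : set V) (f : V -> W) :
    Prop :=
  match n with
  | 0 => forall p, A p -> {for p, continuous f}
  | m.+1 => (forall p, A p -> differentiable f p) /\
            (forall v, class_C m A ('D_v f))
  end.

Definition smooth_on {V W : normedModType K} (A : set V) (f : V -> W) : Prop :=
  forall n, class_C n A f.

Definition plane : normedModType K := (K * K)%type.

Definition diffeomorphism (U V : set plane) (phi : plane -> plane) : Prop :=
  exists psi : plane -> plane,
    [/\ smooth_on U phi, smooth_on V psi,
        set_fun U V phi, set_fun V U psi &
        {in U, cancel phi psi} /\ {in V, cancel psi phi}].

(* A 1-form P dx + Q dy is the map p |-> (P p, Q p); a 2-form F dx /\ dy is its
   coefficient F. *)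
Definition form1 := plane -> plane.
Definition form2 := plane -> K.

Definition form1_app (w : form1) (p v : plane) : K :=
  (w p).1 * v.1 + (w p).2 * v.2.

Definition wedge (w e : form1) : form2 :=
  fun p => (w p).1 * (e p).2 - (w p).2 * (e p).1.

Definition d_x (f : plane -> K) : plane -> K := 'D_((1, 0) : plane) f.
Definition d_y (f : plane -> K) : plane -> K := 'D_((0, 1) : plane) f.

Definition d0 (f : plane -> K) : form1 := fun p => (d_x f p, d_y f p).

Definition d1 (w : form1) : form2 :=
  fun p => d_x (fun q => (w q).2) p - d_y (fun q => (w q).1) p.

(* A foliation of curves is given by its field of tangent lines. *)
Definition tangent_field := plane -> set plane.

Definition defined_by (U : set plane) (X : tangent_field) (w : form1) : Prop :=
  forall p, U p -> X p = [set v | form1_app w p v = 0].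

(* Every line field of a surface is integrable, so no integrability condition
   occurs. *)
Definition is_foliation (D : set plane) (X : tangent_field) : Prop :=
  forall p, D p -> exists (U : set plane) (w : form1),
    [/\ open U, U p, smooth_on U w,
        forall q, U q -> w q != 0 & defined_by (U `&` D) X w].

(* The parameter runs over the interval ]-1, 1[ or over the unit disc. *)
Definition on_integral_curve (D : set plane) (X : tangent_field)
    (p q : plane) : Prop :=
  exists g : K -> plane,
    [/\ smooth_on (ball (0 : K) 1) g,
        forall t, ball (0 : K) 1 t -> D (g t) /\ X (g t) ('D_(1 : K) g t) &
        exists s t, [/\ ball (0 : K) 1 s, ball (0 : K) 1 t, g s = p & g t = q]].

(* The curves of the foliation, i.e. its leaves, are the classes of points
   which can be joined by a finite chain of integral curves in D. *)
Definition same_curve (D : set plane) (X : tangent_field) :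
    plane -> plane -> Prop :=
  clos_refl_trans plane (on_integral_curve D X).

Record is_web (n : nat) (D : set plane) (X : n.-tuple tangent_field) : Prop := {
  web_open : open D;
  web_connected : connected D;
  web_foliation : forall i, is_foliation D (tnth X i);
  web_transversal : forall i j p, i != j -> D p -> tnth X i p <> tnth X j p;
  web_meet_once : forall i j p q, i != j -> D p -> D q ->
    same_curve D (tnth X i) p q -> same_curve D (tnth X j) p q -> p = q
}.

Definition web_equivalent (n : nat)
    (U : set plane) (X : n.-tuple tangent_field)
    (V : set plane) (Y : n.-tuple tangent_field) : Prop :=
  exists2 phi : plane -> plane, diffeomorphism U V phi &
    forall i p v, U p ->
      (tnth X i p v <-> tnth Y i (phi p) ('d phi p v)).

Definition parallel_lines (u : plane) : tangent_field :=
  fun=> [set t *: u | t in [set: K]].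

(* Parallelizability is local: it is asked for near each point of D. *)
Definition parallelizable (D : set plane) (X : 3.-tuple tangent_field) : Prop :=
  forall p, D p -> exists (U V : set plane) (u : 3.-tuple plane),
    let Y := [tuple of map parallel_lines u] in
    [/\ U p, U `<=` D, is_web U X, is_web V Y & web_equivalent U X V Y].

Variant subweb := Sub123 | Sub124 | Sub134 | Sub234.

Definition subweb_foliations (X1 X2 X3 X4 : tangent_field) (s : subweb) :
    3.-tuple tangent_field :=
  match s with
  | Sub123 => [tuple X1; X2; X3]
  | Sub124 => [tuple X1; X2; X4]
  | Sub134 => [tuple X1; X3; X4]
  | Sub234 => [tuple X2; X3; X4]
  end.

Record web_data := WebData {
  om1 : form1; om2 : form1; om3 : form1; om4 : form1;
  theta : form1;
  curv : plane -> K;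
  binv : plane -> K;
  binv1 : plane -> K; binv2 : plane -> K;
  binv11 : plane -> K; binv12 : plane -> K; binv22 : plane -> K
}.

(* On D these equations determine theta, curv, binv and the covariant
   derivatives binv1, ..., binv22 from the forms om1, ..., om4. *)
Record is_web_data (D : set plane) (X1 X2 X3 X4 : tangent_field)
    (w : web_data) : Prop := {
  om1_smooth : smooth_on D (om1 w);
  om2_smooth : smooth_on D (om2 w);
  om3_smooth : smooth_on D (om3 w);
  om4_smooth : smooth_on D (om4 w);
  theta_smooth : smooth_on D (theta w);
  curv_smooth : smooth_on D (curv w);
  inv_smooth : smooth_on D (binv w);
  inv1_smooth : smooth_on D (binv1 w);
  inv2_smooth : smooth_on D (binv2 w);
  inv11_smooth : smooth_on D (binv11 w);
  inv12_smooth : smooth_on D (binv12 w);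
  inv22_smooth : smooth_on D (binv22 w);
  om1_defines : defined_by D X1 (om1 w);
  om2_defines : defined_by D X2 (om2 w);
  om3_defines : defined_by D X3 (om3 w);
  om4_defines : defined_by D X4 (om4 w);
  om_sum : forall p, D p -> om1 w p + om2 w p + om3 w p = 0;
  d_om1 : forall p, D p -> d1 (om1 w) p = wedge (om1 w) (theta w) p;
  d_om2 : forall p, D p -> d1 (om2 w) p = wedge (om2 w) (theta w) p;
  d_om3 : forall p, D p -> d1 (om3 w) p = wedge (om3 w) (theta w) p;
  d_theta : forall p, D p ->
    d1 (theta w) p = curv w p * wedge (om1 w) (om2 w) p;
  om4_eq : forall p, D p -> - om4 w p = binv w p *: om1 w p + om2 w p;
  inv_neq0 : forall p, D p -> binv w p != 0;
  inv_neq1 : forall p, D p -> binv w p != 1;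
  d_inv : forall p, D p ->
    d0 (binv w) p = binv1 w p *: om1 w p + binv2 w p *: om2 w p;
  d_inv1 : forall p, D p ->
    d0 (binv1 w) p - binv1 w p *: theta w p =
    binv11 w p *: om1 w p + binv12 w p *: om2 w p;
  d_inv2 : forall p, D p ->
    d0 (binv2 w) p - binv2 w p *: theta w p =
    binv12 w p *: om1 w p + binv22 w p *: om2 w p
}.

Definition nonconstant_invariant (D : set plane) (w : web_data) : Prop :=
  forall p, D p -> ~ (binv1 w p = 0 /\ binv2 w p = 0).

Definition curvature (w : web_data) (s : subweb) (p : plane) : K :=
  let k := curv w p in
  let a := binv w p in
  let a1 := binv1 w p in let a2 := binv2 w p in
  let a11 := binv11 w p in let a12 := binv12 w p in let a22 := binv22 w p in
  match s with
  | Sub123 => k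
  | Sub124 => a^-1 * (k - a12 / a + a1 * a2 / a ^+ 2)
  | Sub134 => (a - 1)^-1 *
      (k + a2 * (a1 - a2) / (1 - a) ^+ 2 + (a12 - a22) / (1 - a))
  | Sub234 => (a * (a - 1))^-1 *
      (k + (2 * a - 1) * a1 * (a1 - a2) / (a ^+ 2 * (1 - a) ^+ 2)
         + (a11 - a12) / (a * (1 - a)))
  end.

Definition curvature_form (w : web_data) (s : subweb) : form2 :=
  fun p =>
    let a := binv w p in
    let k := curvature w s p in
    let vol := wedge (om1 w) (om2 w) p in
    match s with
    | Sub123 => k * vol
    | Sub124 => a * k * vol
    | Sub134 => (a - 1) * k * vol
    | Sub234 => a * (a - 1) * k * vol
    end.

End Calculus.

Arguments plane : clear implicits.
Arguments form1 : clear implicits.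
Arguments form2 : clear implicits.
Arguments tangent_field : clear implicits.
Arguments web_data : clear implicits.

(* Main.v *)
(** Each 3-subweb is defined by forms [e1, e2, e3] with [e1 + e2 + e3 = 0] and
    a connection form [th] with [d ei = ei /\ th], and its curvature form is
    [d th].  If [d th = 0], then [th = dg] locally, so [s = exp g] makes every
    [s ei] closed; primitives of [s e1] and [s e2] are the coordinates of a chart
    which straightens the subweb.  Conversely, three suitably scaled affine
    functions, pulled back along a chart onto parallel lines, are primitives of
    [s e1, s e2, s e3] for one function [s]; closedness gives [ds = s th],
    whence [d th = 0].

    If the four curvature forms agree, the second covariant derivatives of [a]
    are determined algebraically, and [d a1 = a1 (th + mu om1 + nu om2)] with
    explicit [mu] and [nu].  Hence the form in parentheses is closed where
    [a1 <> 0], and its differential turns out to be [K om1 /\ om2]; likewise for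
    [a2].

    All of this works over [R] and over [R[i]] at once: primitives are limits of
    Riemann sums, local inverses are limits of Picard iterations, and both only
    need the mean value inequality and the convergence of geometrically Cauchy
    sequences. *)

Require Import Defs.
From mathcomp Require Import all_boot all_order all_algebra.
From mathcomp Require Import complex.
From mathcomp Require Import boolp classical_sets functions reals.
From mathcomp Require Import topology normedtype derive.
From HB Require Import structures.
From Stdlib Require Import Relation_Operators.
From mathcomp Require Import prodnormedzmodule landau ring lra.

Set Implicit Arguments.
Unset Strict Implicit.
Unset Printing Implicit Defensive.

Import Order.TTheory GRing.Theory Num.Theory.
Import numFieldNormedType.Exports.

Local Open Scope classical_set_scope.
Local Open Scope ring_scope.

(** * Functions of class C^n *)

(** Nonconstancy of [a] acts through the shape of the second derivatives: [a11] and [a12] contain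
    the factor [a1], while [a12] and [a22] contain [a2]. So [a1] and [a2] each solve an equation
    [ds = s eta] in which [eta] stays regular at the zeros of [s]. One more differentiation gives
    [s d eta = 0], and it suffices that [s] is nonzero at the single point considered; no logarithm
    of [s] is formed. The same argument, [integrating_factor_closed], ends the proof that
    parallelizable webs are flat. The analytic obstacle is that the order of [R[i]] is partial, that
    radii and norms are elements of [K], and that paths have real parameters. Hence the explicit
    constants, the radii such as [r / (r + 1)] in place of minima, and the limits at rate
    [1 / 2 ^+ n], the form in which completeness is available in [calculus_field]. *)

Section Calculus.
Context {K : numFieldType}.
Implicit Types V W : normedModType K.

(** The epsilon estimate is the little-o expansion that characterizes differentiability, and
    [diff_unique] identifies [l] with the differential. Every derivative obtained from a limit
    (primitive, local inverse, real part) comes from here. *)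
Lemma differentiable_approx {V W} (l : {linear V -> W}) (f : V -> W) (x : V) :
  continuous l ->
  (forall e : K, 0 < e ->
     \forall h \near (0 : V), `|f (h + x) - f x - l h| <= e * `|h|) ->
  differentiable f x /\ forall v, 'D_v f x = l v.
Proof.
move=> lc approx.
have fE : f \o shift x = cst (f x) + l +o_ 0 id.
  apply/eqaddoP => e e0 /=; near=> h.
  rewrite [_ h](_ : _ = f (h + x) - f x - l h); first by near: h; exact: approx.
  by rewrite !fctE /= opprD addrA.
have dE := diff_unique lc fE.
have df : differentiable f x by apply/diff_locallyP; rewrite dE.
by split=> // v; rewrite deriveE // dE.
Unshelve. all: by end_near. Qed.

Lemma diff_approx {V W} (f : V -> W) (x : V) (e : K) :
  differentiable f x -> 0 < e ->
  \forall h \near (0 : V), `|f (h + x) - f x - 'D_h f x| <= e * `|h|.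
Proof.
move=> df e0; have /diff_locally/eqaddoP/(_ e e0) := df.
apply: filterS => h; rewrite !fctE /= opprD addrA deriveE //.
Qed.

Lemma near_eq_differentiable {V W} (f g : V -> W) (x : V) :
  (\near x, f x = g x) -> differentiable f x -> differentiable g x.
Proof.
move=> fg df.
apply: (proj1 (@differentiable_approx _ _ ('d f x) _ _ _ _)).
  exact: diff_continuous.
move=> e e0; have := diff_approx df e0.
have fg0 : \forall h \near (0 : V), f (h + x) = g (h + x).
  by move: fg; rewrite (near_shift 0 x) /= subr0.
apply: filterS2 fg0 => h <-.
by rewrite -(nbhs_singleton fg) deriveE.
Qed.

(** Derivative rules give ['D_v f] only at points of [A], whereas [class_C] speaks of the function
    ['D_v f]. Openness of [A] allows the formula to replace the function at each level. *)
Lemma class_C_ext {V W} n (A : set V) (f g : V -> W) :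
  open A -> (forall p, A p -> f p = g p) -> class_C n A f -> class_C n A g.
Proof.
move=> oA; elim: n f g => [|n IH] f g fg /=.
  move=> cf p Ap; have cfp : f x @[x --> p] --> f p := cf p Ap.
  rewrite fg // in cfp; apply: cvg_trans cfp; apply: near_eq_cvg.
  by apply: filterS (open_nbhs_nbhs (conj oA Ap)) => q Aq; rewrite fg.
move=> [df Cf].
have nfg p : A p -> \forall q \near p, f q = g q.
  by move=> Ap; apply: filterS (open_nbhs_nbhs (conj oA Ap)).
split=> [p Ap|v]; first exact: near_eq_differentiable (nfg _ Ap) (df _ Ap).
by apply: IH (Cf v) => p Ap; apply: near_eq_derive; exact: nfg.
Qed.

Lemma class_CS {V W} n (A : set V) (f : V -> W) :
  class_C n.+1 A f -> class_C n A f.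
Proof.
elim: n f => [|n IH] f /= [df Cf]; last by split=> // v; apply: IH.
by move=> p Ap; apply: differentiable_continuous; exact: df.
Qed.

Lemma class_C_subset {V W} n (A B : set V) (f : V -> W) :
  B `<=` A -> class_C n A f -> class_C n B f.
Proof.
move=> BA; elim: n f => [|n IH] f /=; first by move=> Cf p /BA; exact: Cf.
by move=> [df Cf]; split=> [p /BA|v]; [exact: df|exact: IH].
Qed.

Lemma class_C_cst {V W} n (A : set V) (w : W) : class_C n A (fun=> w).
Proof.
elim: n w => [|n IH] w /=; first by move=> p _; exact: cvg_cst.
split=> [p _|v]; first exact: differentiable_cst.
by rewrite (_ : 'D_v _ = fun=> 0) //; apply/funext => p; rewrite derive_cst.
Qed.

Lemma class_C_lin {V W W'} n (A : set V) (l : {linear W -> W'}) (f : V -> W) :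
  open A -> continuous l -> class_C n A f -> class_C n A (l \o f).
Proof.
move=> oA lc; elim: n f => [|n IH] f /=.
  by move=> Cf p Ap; apply: continuous_comp; [exact: Cf|exact: lc].
move=> [df Cf]; split=> [p Ap|v].
  by apply: differentiable_comp; [exact: df|exact: linear_differentiable].
apply: class_C_ext (IH _ (Cf v)) => // p Ap /=.
have dl : differentiable l (f p) by exact: linear_differentiable.
have dfp := df _ Ap.
rewrite [RHS]deriveE; last exact: differentiable_comp.
by rewrite diff_comp //= diff_lin // deriveE.
Qed.

Lemma class_C_linear {V W} n (A : set V) (l : {linear V -> W}) :
  continuous l -> class_C n A l.
Proof.
move=> lc; case: n => [|n] /=; first by move=> p _; exact: lc.
split=> [p _|v]; first exact: linear_differentiable.
rewrite (_ : 'D_v l = fun=> l v); first exact: class_C_cst.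
apply/funext => p.
by rewrite deriveE ?diff_lin //; exact: linear_differentiable.
Qed.

Lemma class_C_add {V W} n (A : set V) (f g : V -> W) :
  open A -> class_C n A f -> class_C n A g ->
  class_C n A (fun p => f p + g p).
Proof.
move=> oA; elim: n f g => [|n IH] f g /=.
  by move=> Cf Cg p Ap; apply: cvgD; [exact: Cf|exact: Cg].
move=> [df Cf] [dg Cg]; split=> [p Ap|v].
  by apply: differentiableD; [exact: df|exact: dg].
apply: class_C_ext (IH _ _ (Cf v) (Cg v)) => // p Ap.
by rewrite -deriveD //; apply: diff_derivable; [exact: df|exact: dg].
Qed.

Lemma class_C_opp {V W} n (A : set V) (f : V -> W) :
  open A -> class_C n A f -> class_C n A (fun p => - f p).
Proof.
move=> oA; elim: n f => [|n IH] f /=.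
  by move=> Cf p Ap; apply: cvgN; exact: Cf.
move=> [df Cf]; split=> [p Ap|v]; first by apply: differentiableN; exact: df.
apply: class_C_ext (IH _ (Cf v)) => // p Ap.
by rewrite -deriveN //; apply: diff_derivable; exact: df.
Qed.

Lemma class_C_mul {V} n (A : set V) (f g : V -> K) :
  open A -> class_C n A f -> class_C n A g ->
  class_C n A (fun p => f p * g p).
Proof.
move=> oA; elim: n f g => [|n IH] f g.
  by move=> Cf Cg p Ap; apply: cvgM; [exact: Cf|exact: Cg].
move=> Cf' Cg'; have [df Cf] := Cf'; have [dg Cg] := Cg'.
split=> [p Ap|v]; first by apply: differentiableM; [exact: df|exact: dg].
apply: class_C_ext (class_C_add oA
  (IH _ _ (class_CS Cf') (Cg v)) (IH _ _ (class_CS Cg') (Cf v))) => //.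
move=> p Ap; apply/esym; apply: (@deriveM _ _ f g); apply: diff_derivable;
  [exact: df|exact: dg].
Qed.

(** The derivative [- f^-1 * f^-1 * 'D_v f] involves the inverse itself, which the induction already
    knows to be of the lower class. *)
Lemma class_C_inv {V} n (A : set V) (f : V -> K) :
  open A -> (forall p, A p -> f p != 0) -> class_C n A f ->
  class_C n A (fun p => (f p)^-1).
Proof.
move=> oA f0; elim: n => [|n IH].
  by move=> Cf p Ap; apply: cvgV; [exact: f0|exact: Cf].
move=> Cf; have Cn := IH (class_CS Cf).
case: Cf => df Cf; split=> [p Ap|v].
  by apply: differentiableV; [exact: df|exact: f0].
apply: class_C_ext (class_C_opp oA (class_C_mul oA
  (class_C_mul oA Cn Cn) (Cf v))) => // p Ap.
rewrite [RHS](@deriveV _ _ f p v (f0 _ Ap) (diff_derivable (df _ Ap))).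
by rewrite scaleNr expr2 invfM.
Qed.

Lemma class_C_pair {V} n (A : set V) (f g : V -> K) :
  open A -> class_C n A f -> class_C n A g ->
  class_C n A (fun p => (f p, g p) : plane K).
Proof.
move=> oA; elim: n f g => [|n IH] f g /=.
  by move=> Cf Cg p Ap; apply: (cvg_pair (F := nbhs p) (Cf p Ap) (Cg p Ap)).
move=> [df Cf] [dg Cg]; split=> [p Ap|v].
  by apply: differentiable_pair; [exact: df|exact: dg].
apply: class_C_ext (IH _ _ (Cf v) (Cg v)) => // p Ap.
have dfp := df _ Ap; have dgp := dg _ Ap.
rewrite [RHS]deriveE; last exact: differentiable_pair.
by rewrite diff_pair // !deriveE.
Qed.

Lemma fst_continuous : continuous (fst : plane K -> K).
Proof. by move=> p; exact: cvg_fst. Qed.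

Lemma snd_continuous : continuous (snd : plane K -> K).
Proof. by move=> p; exact: cvg_snd. Qed.

Lemma planeE (v : plane K) : v = v.1 *: (1, 0) + v.2 *: (0, 1).
Proof.
by case: v => a b; congr pair; rewrite /= ?scaler0 ?addr0 ?add0r /GRing.scale /= mulr1.
Qed.

Lemma derive_plane {W} (f : plane K -> W) (p v : plane K) :
  differentiable f p ->
  'D_v f p = v.1 *: 'D_(1, 0) f p + v.2 *: 'D_(0, 1) f p.
Proof. by move=> df; rewrite !deriveE // {1}(planeE v) linearD !linearZ. Qed.

Lemma derive_comp {V W W'} (f : V -> W) (g : W -> W') (p v : V) :
  differentiable f p -> differentiable g (f p) ->
  'D_v (g \o f) p = 'D_('D_v f p) g (f p).
Proof.
move=> df dg; rewrite [LHS]deriveE; last exact: differentiable_comp.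
by rewrite diff_comp //= !deriveE.
Qed.

(** With a plane in the middle, the chain rule is a sum of two products of scalar functions, so the
    induction closes without bilinear maps. *)
Lemma class_C_comp {V} n (A : set V) (B : set (plane K)) (f : V -> plane K)
    (g : plane K -> K) :
  open A -> (forall p, A p -> B (f p)) -> class_C n A f -> class_C n B g ->
  class_C n A (g \o f).
Proof.
move=> oA AB; elim: n g => [|n IH] g.
  by move=> Cf Cg p Ap; apply: continuous_comp; [exact: Cf|exact/Cg/AB].
move=> Cf' [dg Cg]; have [df Cf] := Cf'; split=> [p Ap|v].
  by apply: differentiable_comp; [exact: df|exact/dg/AB].
have Cn := class_CS Cf'.
have C1 := class_C_lin (l := @fst K K : {linear plane K -> K}) oA
  fst_continuous (Cf v).
have C2 := class_C_lin (l := @snd K K : {linear plane K -> K}) oA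
  snd_continuous (Cf v).
apply: class_C_ext (class_C_add oA (class_C_mul oA C1
  (IH _ Cn (Cg (1, 0)))) (class_C_mul oA C2 (IH _ Cn (Cg (0, 1))))) => //.
move=> p Ap /=; rewrite [RHS]derive_comp; [|exact: df|exact/dg/AB].
by rewrite [RHS]derive_plane //; exact/dg/AB.
Qed.

End Calculus.

(** * The scalar fields *)

(* In [R[i]] the inequality [0 <= t <= 1] means that [t] is a real number of the
   unit interval, so the same statement covers both scalar fields. *)
Record calculus_field (K : numFieldType) : Prop := {
  mean_value : forall (g : K -> K) (M : K),
    (forall t : K, 0 <= t <= 1 -> differentiable g t /\ `|'D_1 g t| <= M) ->
    `|g 1 - g 0| <= M;
  geometric_cvg : forall (u : nat -> K) (C : K),
    (forall n, `|u n.+1 - u n| <= C / 2 ^+ n) ->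
    exists l, forall n, `|u n - l| <= 4 * C / 2 ^+ n;
  small_pow2 : forall C e : K, 0 <= C -> 0 < e -> exists n, C / 2 ^+ n < e;
  connected_unit_segment : connected [set t : K | 0 <= t <= 1]
}.
Arguments mean_value {K} _ {g M}.
Arguments geometric_cvg {K} _ {u C}.
Arguments small_pow2 {K} _ {C e}.
Arguments connected_unit_segment {K}.

Section Real.
Variable R : realType.

(** Kept one-sided so that it applies to the real part of a complex function, and to [g] and [- g]
    in turn for the absolute value. *)
Lemma real_mean_value (g dg : R -> R) (M : R) :
  (forall t : R, 0 <= t <= 1 -> is_derive t 1 g (dg t) /\ dg t <= M) ->
  g 1 - g 0 <= M.
Proof.
move=> dgM.
have dgi (t : R) : t \in `]0, 1[%R -> is_derive t (1 : R) g (dg t).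
  by rewrite in_itv /= => /andP[t0 t1]; apply: (dgM t _).1; rewrite !ltW.
have cg : {within `[0, 1], continuous g}.
  apply: derivable_within_continuous => t; rewrite in_itv /= => t01.
  by have [[]] := dgM t t01.
have [t] := MVT (ltr01) dgi cg.
by rewrite in_itv /= subr0 mulr1 => /andP[t0 t1] ->; apply: (dgM t _).2; rewrite !ltW.
Qed.

(** The tail of the geometric series after index [n] is [2 * C / 2 ^+ n], so the intervals of that
    radius about [u n] are nested; the limit is the supremum of their left ends. *)
Lemma real_geometric_cvg (u : nat -> R) (C : R) :
  (forall n, `|u n.+1 - u n| <= C / 2 ^+ n) ->
  exists l, forall n, `|u n - l| <= 2 * C / 2 ^+ n.
Proof.
move=> uC.
pose a n := u n - 2 * C / 2 ^+ n; pose b n := u n + 2 * C / 2 ^+ n.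
have half n : C / 2 ^+ n = 2 * (C / 2 ^+ n.+1).
  by rewrite exprS; field; rewrite expf_eq0 pnatr_eq0 andbF.
have C0 n : 0 <= C / 2 ^+ n by apply: le_trans (uC n).
have aS n : a n <= a n.+1.
  by move: (uC n); rewrite ler_norml /a -!mulrA half => /andP[]; lra.
have bS n : b n.+1 <= b n.
  by move: (uC n); rewrite ler_norml /b -!mulrA half => /andP[]; lra.
have a_le m n : (m <= n)%N -> a m <= a n.
  by move=> /subnK <-; elim: (n - m)%N => // k; rewrite addSn => /le_trans; apply.
have b_le m n : (m <= n)%N -> b n <= b m.
  by move=> /subnK <-; elim: (n - m)%N => // k; rewrite addSn; apply: le_trans.
have ab m n : a m <= b n.
  have abk k : a k <= b k by move: (C0 k); rewrite /a /b; lra.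
  case: (leqP m n) => mn; first exact: le_trans (a_le _ _ mn) _.
  exact: le_trans (abk m) (b_le _ _ (ltnW mn)).
exists (sup (range a)) => n.
have ubb k : ubound (range a) (b k) by move=> _ [m _ <-].
have hs : has_sup (range a) by split; [exists (a 0), 0|exists (b 0)].
have al : a n <= sup (range a) by apply: ub_le_sup; [exists (b 0)|exists n].
have lb : sup (range a) <= b n by apply: ge_sup (ubb n); exists (a 0), 0.
by rewrite ler_norml; move: al lb; rewrite /a /b; lra.
Qed.

Lemma real_small_pow2 (C e : R) : 0 <= C -> 0 < e -> exists n, C / 2 ^+ n < e.
Proof.
move=> C0 e0; exists (Num.bound (C / e)).
have Ce : 0 <= C / e by rewrite divr_ge0 // ltW.
rewrite ltr_pdivrMr ?exprn_gt0 // mulrC -ltr_pdivrMr //.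
apply: lt_le_trans (archi_boundP Ce) _.
by rewrite -natrX ler_nat ltnW // ltn_expl.
Qed.

Lemma real_calculus_field : calculus_field R.
Proof.
split=> [g M dg|u C uC|C e|].
- rewrite ler_norml; apply/andP; split; last first.
    apply: (@real_mean_value g (fun t => 'D_1 g t) _) => t t01.
    have [dgt Mt] := dg t t01; split; last exact: le_trans (ler_norm _) Mt.
    exact/derivableP/diff_derivable.
  rewrite -[leRHS]opprK lerN2 opprB addrC -[g 0]opprK.
  apply: (@real_mean_value (fun t => - g t) (fun t => - 'D_1 g t) _) => t t01.
  have [dgt Mt] := dg t t01; split; last first.
    by apply: le_trans (ler_norm _) _; rewrite normrN.
  exact/is_deriveN/derivableP/diff_derivable.
- have [l lP] := real_geometric_cvg uC; exists l => n.
  apply: le_trans (lP n) _.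
  have : 0 <= C / 2 ^+ n by apply: le_trans (uC n).
  by rewrite -!mulrA; lra.
- exact: real_small_pow2.
- rewrite (_ : [set t | _] = `[0, 1]%classic); first exact: segment_connected.
  by apply/seteqP; split=> t; rewrite /= in_itv.
Qed.

End Real.

Section Complex.
Variable R : realType.
Local Open Scope complex_scope.
Local Notation C := (R[i] : numFieldType).
Local Notation Re := (@complex.Re R).
Local Notation Im := (@complex.Im R).

Let toC (x : R) : C := real_complex _ x.

(** A positive radius in [R[i]] is a real number, so its real part serves as a radius in [R]. *)
Lemma near_real_complex (P : set C) (x : R) :
  (\forall z \near toC x, P z) -> \forall y \near x, P (toC y).
Proof.
move=> /nbhs_ballP[e /= e0 eP]; apply/nbhs_ballP; exists (Re e) => /=.
  by move: e0; rewrite ltcE => /andP[].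
move=> y; rewrite /ball /= => xy; apply: eP; rewrite /ball /= /toC.
have eE : e = (Re e)%:C by rewrite RRe_real // gtr0_real.
by rewrite -rmorphB normc_def /= expr0n addr0 sqrtr_sqr eE ltcR.
Qed.

Let ReB (x y : C) : Re (x - y) = Re x - Re y.
Proof. by case: x; case: y. Qed.

Let Re_realM (x : R) (y : C) : Re (toC x * y) = x * Re y.
Proof. by case: y => a b; rewrite /= mul0r subr0. Qed.

Lemma real_complex_continuous : continuous toC.
Proof. by move=> x P /near_real_complex. Qed.

(** A complex derivative restricted to the real axis is a real one. The factor [c] lets the mean
    value inequality look in any direction of the complex plane. *)
Lemma is_derive_Re_mul (c : C) (g : C -> C) (s : R) :
  differentiable g (toC s) ->
  is_derive s 1 (fun t => Re (c * g (toC t))) (Re (c * 'D_1 g (toC s))).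
Proof.
move=> dg; set d := Re _.
have [dh Dh] : differentiable (fun t : R => Re (c * g (toC t))) s /\
    forall v : R, 'D_v (fun t : R => Re (c * g (toC t))) s = d *: v.
  apply: (@differentiable_approx R R R ( *:%R d : {linear R -> R})).
    exact: scaler_continuous.
  move=> e e0.
  (* This tolerance absorbs the later multiplication by [c]; the [+ 1] covers [c = 0]. *)
  have e1 : 0 < toC e / (`|c| + 1) by rewrite divr_gt0 ?ltcR // ltr_wpDl.
  have := diff_approx dg e1.
  move=> /(@near_real_complex _ 0); apply: filterS => h hP.
  have Dh : 'D_(toC h) g (toC s) = toC h * 'D_1 g (toC s).
    by rewrite !deriveE // -[toC h in LHS]mulr1 -[_ * 1]/(toC h *: 1) linearZ.
  have ReE : Re (c * g (toC (h + s))) - Re (c * g (toC s)) - d *: h =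
      Re (c * (g (toC h + toC s) - g (toC s) - 'D_(toC h) g (toC s))).
    rewrite -[toC h + _]rmorphD Dh. rewrite 2![in RHS]mulrBr !ReB mulrCA Re_realM.
    by rewrite [d *: h]mulrC.
  rewrite ReE -lecR; apply: le_trans (normc_ge_Re _) _.
  rewrite normrM; apply: le_trans (ler_wpM2l (normr_ge0 c) hP) _.
  have -> : (e * `|h|)%:C = toC e * `|toC h|.
    by rewrite rmorphM /= [`|toC h|]normc_def /= expr0n addr0 sqrtr_sqr.
  have c1 : `|c| / (`|c| + 1) <= 1 by rewrite ler_pdivrMr ?ltr_wpDl // mul1r lerDl.
  rewrite mulrA ler_wpM2r // mulrCA ler_piMr // ler0c ltW //.
apply: DeriveDef; last by rewrite Dh [LHS]mulr1.
exact: diff_derivable.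
Qed.

(* The real mean value inequality is applied to [Re (z^* g t)], where
   [z = g 1 - g 0]: its increment is [`|z| ^+ 2]. *)
Lemma complex_mean_value (g : C -> C) (M : C) :
  (forall t : C, 0 <= t <= 1 -> differentiable g t /\ `|'D_1 g t| <= M) ->
  `|g 1 - g 0| <= M.
Proof.
move=> gM.
pose z := g 1 - g 0.
have M0 : 0 <= M by apply: le_trans (proj2 (gM 0 _)); rewrite ?lexx ?ler01.
have ME : M = (Re M)%:C by rewrite RRe_real // ger0_real.
have [z0|z0] := eqVneq z 0; first by rewrite -/z z0 normr0.
have zE : `|z| = (Re `|z|)%:C by rewrite RRe_real // normr_real.
have toC01 (t : R) : 0 <= t <= 1 -> 0 <= toC t <= 1.
  by rewrite -[0 : C]/(toC 0) -[1 : C]/(toC 1) !lecR.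
suff : Re (`|z| * `|z|) <= Re (`|z| * M).
  rewrite -lecR !RRe_real ?ger0_real ?mulr_ge0 //.
  by rewrite ler_pM2l // normr_gt0.
have <- : Re (z^* * g (toC 1)) - Re (z^* * g (toC 0)) = Re (`|z| * `|z|).
  by rewrite -ReB -mulrBr -[_ - _]/z -expr2 sqr_normc mulrC.
apply: (@real_mean_value R (fun t => Re (z^* * g (toC t)))
  (fun t => Re (z^* * 'D_1 g (toC t))) _) => t t01.
have [dg Mg] := gM _ (toC01 _ t01); split; first exact: is_derive_Re_mul.
apply: le_trans (ler_norm _) _; rewrite -lecR.
apply: le_trans (normc_ge_Re _) _.
rewrite normrM normcJ RRe_real ?ger0_real ?mulr_ge0 //.
by rewrite ler_wpM2l.
Qed.

Lemma complex_norm_le (z : C) : `|z| <= (`|Re z| + `|Im z|)%:C.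
Proof.
rewrite {1}[z]complexE rmorphD; apply: le_trans (ler_normD _ _) _.
rewrite normrM !normc_def /= !expr0n /= !(addr0, add0r) !sqrtr_sqr.
by rewrite normr1 mul1r.
Qed.

Lemma complex_calculus_field : calculus_field C.
Proof.
split=> [|u M uM|M e M0 e0|].
- exact: complex_mean_value.
- have M0 : 0 <= M.
    apply: le_trans (normr_ge0 (u 1%N - u 0%N)) _.
    by have := uM 0%N; rewrite expr0 divr1.
  have ME n : M / 2 ^+ n = (Re M / 2 ^+ n)%:C.
    by rewrite rmorphM fmorphV rmorphXn rmorph_nat /= RRe_real // ger0_real.
  have uR n : `|Re (u n.+1) - Re (u n)| <= Re M / 2 ^+ n.
    by rewrite -ReB -lecR -ME; apply: le_trans (normc_ge_Re _) (uM n).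
  have ImB (x y : C) : Im (x - y) = Im x - Im y by case: x; case: y.
  have uI n : `|Im (u n.+1) - Im (u n)| <= Re M / 2 ^+ n.
    rewrite -ImB -lecR -ME; apply: le_trans (uM n).
    have -> : Im (u n.+1 - u n) = - Re ((u n.+1 - u n) * 'i) by rewrite ReiNIm opprK.
    rewrite normrN; apply: le_trans (normc_ge_Re _) _.
    by rewrite normrM [`|'i|]normc_def /= expr0n add0r sqrtr_sqr normr1 mulr1.
  have [a aP] := @real_geometric_cvg R (fun n => Re (u n)) (Re M) uR.
  have [b bP] := @real_geometric_cvg R (fun n => Im (u n)) (Re M) uI.
  (* The real and imaginary parts each contribute [2 * M / 2 ^+ n], whence the constant 4 in
     [geometric_cvg]. *)
  exists (a +i* b) => n; apply: le_trans (complex_norm_le _) _.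
  rewrite -mulrA ME -[4]/(4%:R) -(rmorph_nat (real_complex R)) -rmorphM lecR.
  move: (aP n) (bP n); rewrite ReB ImB /= -!mulrA; lra.
- have ME : M = (Re M)%:C by rewrite RRe_real // ger0_real.
  have eE : e = (Re e)%:C by rewrite RRe_real // gtr0_real.
  have [||n nP] := @real_small_pow2 R (Re M) (Re e).
  + by rewrite -ler0c -ME.
  + by rewrite -ltcR -eE.
  exists n; rewrite ME eE -(rmorph_nat (real_complex R)) -rmorphXn -fmorphV.
  by rewrite -rmorphM ltcR.
- rewrite (_ : [set t : C | _] = toC @` `[0, 1]%classic).
    apply: connected_continuous_connected; first exact: segment_connected.
    exact/continuous_subspaceT/real_complex_continuous.
  apply/seteqP; split=> [t /= /andP[t0 t1]|_ [t /= t01 <-]].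
    have tE : t = (Re t)%:C by rewrite RRe_real // ger0_real.
    by exists (Re t) => //; rewrite /= in_itv /= -!lecR -tE t0.
  by move: t01; rewrite /= in_itv /= -[0 : C]/(toC 0) -[1 : C]/(toC 1) !lecR.
Qed.

End Complex.

Lemma scalars_calculus_field (R : realType) (c : category) :
  calculus_field (scalars R c).
Proof. by case: c; [exact: real_calculus_field|exact: complex_calculus_field]. Qed.

(** * Mean value inequality and symmetry of second derivatives *)

Section Plane.
Context {K : numFieldType}.
Implicit Types p q u v : plane K.

Lemma plane_norm_le v (M : K) : `|v.1| <= M -> `|v.2| <= M -> `|v| <= M.
Proof. by rewrite prod_normE /Num.max; case: ifP. Qed.

(** The plane carries the max norm. Since the order of [K] may be partial, the comparability of the
    two coordinate norms has to be supplied: both are real. *)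
Lemma norm_fst_le v : `|v.1| <= `|v|.
Proof.
by rewrite prod_normE comparable_le_max ?lexx // real_comparable ?normr_real.
Qed.

Lemma norm_snd_le v : `|v.2| <= `|v|.
Proof.
by rewrite prod_normE comparable_le_max ?lexx ?orbT // real_comparable ?normr_real.
Qed.

(** The differential with partial derivatives [a] and [b], as a linear map that can be handed to
    [differentiable_approx]. *)
Definition lin2 (a b : K) (v : plane K) : K := a * v.1 + b * v.2.

Lemma lin2_is_linear a b : linear (lin2 a b).
Proof. by move=> k [x1 x2] [y1 y2]; rewrite /lin2 /= /GRing.scale /=; ring. Qed.

HB.instance Definition _ a b :=
  GRing.isLinear.Build K (plane K) K *:%R (lin2 a b) (lin2_is_linear a b).

Lemma norm_lin2_le a b v (M : K) :
  `|a| <= M -> `|b| <= M -> `|lin2 a b v| <= 2 * M * `|v|.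
Proof.
move=> aM bM; apply: le_trans (ler_normD _ _) _.
have M0 : 0 <= M by apply: le_trans aM.
rewrite !normrM -mulrA mulr_natl mulr2n lerD // ler_pM // ?norm_fst_le //.
exact: norm_snd_le.
Qed.

Lemma lin2_continuous a b : continuous (lin2 a b).
Proof.
move=> p; have c1 : a * v.1 @[v --> p] --> a * p.1.
  by apply: cvgMl_tmp; exact: fst_continuous.
have c2 : b * v.2 @[v --> p] --> b * p.2.
  by apply: cvgMl_tmp; exact: snd_continuous.
exact: cvgD c1 c2.
Qed.

Lemma derive_lin2 (f : plane K -> K) p v : differentiable f p ->
  'D_v f p = lin2 (d_x f p) (d_y f p) v.
Proof.
move=> df; rewrite derive_plane // /lin2.
by rewrite mulrC [d_y f p * _]mulrC.
Qed.

End Plane.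

Section Segments.
Context {K : numFieldType} (HK : calculus_field K).

Lemma le_of_pow2 (x y C : K) : 0 <= C ->
  (forall n, x <= y + C / 2 ^+ n) -> x <= y.
Proof.
move=> C0 xy; apply/ler_addgt0Pr => e e0.
have [n nP] := small_pow2 HK C0 e0.
by apply: le_trans (xy n) _; rewrite lerD2l ltW.
Qed.

(** Subtracting [t * (h * c)] makes the derivative along the segment [h * ('D_v f - c)], so the
    inequality bounds a first-order error. Separating [h] from [v] keeps the factor [|h|] outside a
    bound on a fixed directional derivative. *)
Lemma segment_mean_value {V : normedModType K} (f : V -> K) (p v : V) (h c M : K) :
  (forall t : K, 0 <= t <= 1 ->
     differentiable f (p + t *: (h *: v)) /\
     `|'D_v f (p + t *: (h *: v)) - c| <= M) ->
  `|f (p + h *: v) - f p - h * c| <= `|h| * M.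
Proof.
move=> fM; pose g (t : K) := f (p + t *: (h *: v)) - t * (h * c).
have -> : f (p + h *: v) - f p - h * c = g 1 - g 0.
  by rewrite /g !scale1r scale0r addr0 mul1r mul0r subr0 addrAC.
apply: (mean_value HK) => t t01.
have [df Df] := fM t t01.
pose l (s : K) := p + s *: (h *: v).
have dl : is_diff t l ( *:%R^~ (h *: v)).
  have := is_diffD (is_diff_cst p t) (is_diff_scalel t (h *: v)).
  by rewrite add0r.
have dm : is_diff t (fun s : K => s * (h * c)) ( *:%R^~ (h * c)).
  exact: (is_diff_scalel t (h * c : K)).
have dfl : differentiable (f \o l) t by exact: differentiable_comp.
split; first exact: (differentiableB dfl (ex_diff (is_diff_def := dm))).
have -> : 'D_1 g t = 'D_1 (f \o l) t - 'D_1 (fun s : K => s * (h * c)) t.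
  by apply: (@deriveB _ _ _ (f \o l)); apply: diff_derivable.
rewrite derive_comp // [X in 'D_X f _]deriveE // (diff_val (is_diff_def := dl)).
rewrite [X in _ - X]deriveE // (diff_val (is_diff_def := dm)) !scale1r.
have -> : 'D_(h *: v) f (l t) = h * 'D_v f (l t).
  by rewrite !deriveE // linearZ.
by rewrite -mulrBr normrM ler_wpM2l.
Qed.

Lemma ballE {V : normedModType K} (c q : V) (r : K) :
  ball c r q = (`|q - c| < r) :> Prop.
Proof. by rewrite -ball_normE /= distrC. Qed.

Lemma near_ball {V : normedModType K} (p : V) (P : set V) :
  (\forall q \near p, P q) ->
  exists2 r : K, 0 < r <= 1 & forall q, ball p r q -> P q.
Proof.
move=> /nbhs_ballP[r /= r0 rP].
(* Below both [r] and [1], without a minimum in the partial order. *)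
exists (r / (r + 1)).
  by rewrite divr_gt0 ?addr_gt0 // ler_pdivrMr ?addr_gt0 // mul1r lerDl ler01.
move=> q; rewrite ballE => qr; apply: rP; rewrite ballE; apply: lt_le_trans qr _.
by rewrite ler_pdivrMr ?addr_gt0 // ler_peMr ?lerDr ?ltW.
Qed.

Lemma ball_segment {V : normedModType K} (c p q : V) (r t : K) :
  ball c r p -> ball c r q -> 0 <= t <= 1 -> ball c r (p + t *: (q - p)).
Proof.
rewrite !ballE => pr qr /andP[t0 t1].
have -> : p + t *: (q - p) - c = (1 - t) *: (p - c) + t *: (q - c).
  rewrite scalerBl scale1r -[RHS]addrA [- _ + _]addrC -scalerBr.
  have -> : q - c - (p - c) = q - p by rewrite opprB addrA subrK.
  exact: addrAC.
apply: le_lt_trans (ler_normD _ _) _; rewrite !normrZ (ger0_norm t0).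
rewrite ger0_norm ?subr_ge0 //.
have -> : r = (1 - t) * r + t * r by rewrite -mulrDl subrK mul1r.
(* The strict inequality comes from the summand with factor [t], which is lost when [t = 0]. *)
have [->|tn0] := eqVneq t 0; first by rewrite subr0 !mul0r !addr0 !mul1r.
apply: ler_ltD; first by rewrite ler_wpM2l ?subr_ge0 // ltW.
by rewrite ltr_pM2l // lt_def tn0.
Qed.

(** Used with [a = b = 0] as a Lipschitz bound, with the values of a form at a point for
    differentiability, and with the rows of the identity for the contraction estimate. The 2 comes
    from the max norm. *)
Lemma ball_mean_value (f : plane K -> K) (c : plane K) (r a b M : K) :
  (forall q, ball c r q -> [/\ differentiable f q,
     `|d_x f q - a| <= M & `|d_y f q - b| <= M]) ->
  forall p q, ball c r p -> ball c r q ->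
    `|f q - f p - lin2 a b (q - p)| <= 2 * M * `|q - p|.
Proof.
move=> fM p q pr qr.
have := @segment_mean_value _ f p (q - p) 1 (lin2 a b (q - p))
  (2 * M * `|q - p|).
rewrite scale1r subrKC mul1r normr1 mul1r; apply => t t01.
have [df fx fy] := fM _ (ball_segment pr qr t01); split=> //.
rewrite derive_lin2 //.
have -> (x y x' y' : K) (v : plane K) : lin2 x y v - lin2 x' y' v = lin2 (x - x') (y - y') v.
  by rewrite /lin2; ring.
exact: norm_lin2_le.
Qed.

Lemma derive0_const {V : normedModType K} (f : V -> K) (p v : V) :
  (forall t : K, 0 <= t <= 1 ->
     differentiable f (p + t *: v) /\ 'D_v f (p + t *: v) = 0) ->
  f (p + v) = f p.
Proof.
move=> f0; have := @segment_mean_value _ f p v 1 0 0.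
rewrite scale1r mulr0 subr0 mulr0 => H; apply/eqP.
rewrite -subr_eq0 -normr_le0; apply: H => t t01; have [df ->] := f0 t t01.
by rewrite subr0 normr0.
Qed.

Lemma derive_translate {V : normedModType K} (f : V -> K) (q w u : V) :
  differentiable f (q + w) ->
  differentiable (fun x => f (x + w)) q /\
  'D_u (fun x => f (x + w)) q = 'D_u f (q + w).
Proof.
move=> df; pose l (x : V) := x + w.
have dl : is_diff q l id.
  by have := is_diffD (is_diff_id q) (is_diff_cst w q); rewrite addr0.
have dlq : differentiable l q by exact: ex_diff.
split; first exact: (differentiable_comp dlq df).
rewrite -[LHS]/('D_u (f \o l) q) (derive_comp u dlq df).
by rewrite (deriveE u dlq) (diff_val (is_diff_def := dl)).
Qed.

Lemma near_norm_le {V : normedModType K} (f : V -> K) (p : V) (e : K) :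
  {for p, continuous f} -> 0 < e -> \forall q \near p, `|f q - f p| <= e.
Proof.
move=> cf e0; have /cvgrPdist_le/(_ _ e0) : f x @[x --> p] --> f p := cf.
by apply: filterS => q; rewrite distrC.
Qed.

(** Two mean value estimates: the second difference is the increment of [m] along [u], and the
    derivative of [m] along [u] is an increment of ['D_u f] along [v]. *)
Lemma second_difference {V : normedModType K} (f : V -> K) (p u v : V) (h c M : K) :
  (forall s t : K, 0 <= s <= 1 -> 0 <= t <= 1 ->
     let q := p + s *: (h *: u) + t *: (h *: v) in
     [/\ differentiable f q, differentiable ('D_u f) q &
        `|'D_v ('D_u f) q - c| <= M]) ->
  `|f (p + h *: u + h *: v) - f (p + h *: u) - (f (p + h *: v) - f p) - h * (h * c)|
    <= `|h| * (`|h| * M).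
Proof.
move=> fM.
pose m x := f (x + h *: v) - f x.
have i0 : 0 <= (0 : K) <= 1 by rewrite lexx ler01.
have i1 : 0 <= (1 : K) <= 1 by rewrite lexx ler01.
have := @segment_mean_value _ m p u h (h * c) (`|h| * M).
have -> : m (p + h *: u) = f (p + h *: u + h *: v) - f (p + h *: u) by [].
apply=> s s01.
have [d1 _ _] := fM s 1 s01 i1; have [d0 _ _] := fM s 0 s01 i0.
move: d1 d0; rewrite scale1r scale0r addr0 => d1 d0.
set q := p + s *: (h *: u) in d0 d1 *.
have [dfs Dfs] := derive_translate u d1.
split; first exact: (differentiableB dfs d0).
have -> : 'D_u m q = 'D_u f (q + h *: v) - 'D_u f q.
  rewrite -Dfs; apply: (@deriveB _ _ _ (fun x : V => f (x + h *: v)) f);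
    exact: diff_derivable.
have := @segment_mean_value _ ('D_u f) q v h c M; apply => t t01.
by have [] := fM s t s01 t01.
Qed.

(* Both mixed derivatives are the limit of the same second difference. *)
Lemma Schwarz {V : normedModType K} (f : V -> K) (A : set V) (p u v : V) :
  open A -> A p -> class_C 2 A f -> 'D_u ('D_v f) p = 'D_v ('D_u f) p.
Proof.
move=> oA Ap [df Cf].
have [dfu Cfu] := Cf u; have [dfv Cfv] := Cf v.
set a := 'D_u _ p; set b := 'D_v _ p.
apply/eqP; rewrite -subr_eq0 -normr_le0; apply/ler_addgt0Pr => e e0.
rewrite add0r.
have e2 : 0 < e / 2 by rewrite divr_gt0.
have na := near_norm_le (Cfu v _ Ap) e2.
have nb := near_norm_le (Cfv u _ Ap) e2.
have nA := open_nbhs_nbhs (conj oA Ap).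
have [r /andP[r0 _] rP] := near_ball (filterI nA (filterI na nb)).
have [h h0 hr] : exists2 h : K, 0 < h & h * (`|u| + `|v|) < r.
  have n0 : 0 < `|u| + `|v| + 1 by rewrite ltr_wpDl ?addr_ge0.
  exists (r / (`|u| + `|v| + 1)); first by rewrite divr_gt0.
  by rewrite mulrAC ltr_pdivrMr // ltr_pM2l // ltrDl.
have hP (s t : K) : 0 <= s <= 1 -> 0 <= t <= 1 ->
    ball p r (p + s *: (h *: u) + t *: (h *: v)).
  move=> /andP[s0 s1] /andP[t0 t1]; rewrite ballE addrC !addrA addNr add0r.
  apply: le_lt_trans (ler_normD _ _) _; rewrite !normrZ !ger0_norm ?(ltW h0) //.
  apply: (@le_lt_trans _ _ (h * `|u| + h * `|v|)).
    by rewrite lerD // ler_piMl // mulr_ge0 // ltW.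
  by rewrite -mulrDr.
have Du : `|f (p + h *: u + h *: v) - f (p + h *: u) - (f (p + h *: v) - f p)
    - h * (h * b)| <= `|h| * (`|h| * (e / 2)).
  have := @second_difference _ f p u v h b (e / 2); apply => s t s01 t01 q.
  have [Aq [bq _]] := rP _ (hP s t s01 t01).
  by split=> //; [exact: df|exact: dfu].
have Dv : `|f (p + h *: v + h *: u) - f (p + h *: v) - (f (p + h *: u) - f p)
    - h * (h * a)| <= `|h| * (`|h| * (e / 2)).
  have := @second_difference _ f p v u h a (e / 2); apply => s t s01 t01 q.
  have [Aq [_ aq]] := rP _ (hP t s t01 s01).
  rewrite /q addrAC.
  by split=> //; [exact: df|exact: dfv].
have h2 : 0 < h * h by rewrite mulr_gt0.
rewrite -(ler_pM2l h2).
have -> : h * h * `|a - b| = `|h * (h * a) - h * (h * b)|.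
  by rewrite -!mulrBr !normrM gtr0_norm // mulrA.
have -> : h * h * e = `|h| * (`|h| * (e / 2)) + `|h| * (`|h| * (e / 2)).
  by rewrite gtr0_norm // -2!mulrDr -splitr mulrA.
apply: le_trans (lerD Du Dv).
apply: le_trans _ (ler_normB _ _).
rewrite le_eqVlt; apply/orP; left; apply/eqP; congr (`|_|).
by rewrite [p + h *: v + h *: u]addrAC; ring.
Qed.

End Segments.

(** * Primitives of closed forms *)

Section Primitive.
Context {K : numFieldType} (HK : calculus_field K).

(** On each of the [N] pieces [dg] varies by at most [B / N], so the increment of [g] differs from
    the left-end term by at most [B / N ^ 2]. The explicit rate is what makes the sums geometrically
    Cauchy later. *)
Lemma riemann_sum (g dg : K -> K) (B : K) (N : nat) : (0 < N)%N ->
  (forall t : K, 0 <= t <= 1 -> [/\ differentiable g t, 'D_1 g t = dg t,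
     differentiable dg t & `|'D_1 dg t| <= B]) ->
  `|\sum_(k < N) dg (k%:R / N%:R) / N%:R - (g 1 - g 0)| <= B / N%:R.
Proof.
move=> N0 gB.
have Npos : 0 < N%:R :> K by rewrite ltr0n.
have B0 : 0 <= B.
  have i0 : 0 <= (0 : K) <= 1 by rewrite lexx ler01.
  by have [_ _ _] := gB 0 i0; apply: le_trans.
have in01 (k : 'I_N) (t : K) : 0 <= t <= 1 -> 0 <= k%:R / N%:R + t * N%:R^-1 <= 1.
  move=> /andP[t0 t1]; rewrite addr_ge0 ?divr_ge0 ?mulr_ge0 ?invr_ge0 ?ler0n //=.
  rewrite -mulrDl ler_pdivrMr // mul1r.
  by apply: le_trans (lerD (lexx _) t1) _; rewrite natr1 ler_nat.
have step (k : 'I_N) :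
    `|g (k%:R / N%:R + N%:R^-1) - g (k%:R / N%:R) - dg (k%:R / N%:R) / N%:R|
      <= B / N%:R / N%:R.
  have scale (x : K) : x *: (1 : K) = x by rewrite /GRing.scale /= mulr1.
  have := @segment_mean_value _ HK _ g (k%:R / N%:R) 1 N%:R^-1 (dg (k%:R / N%:R)) (B / N%:R).
  rewrite scale [N%:R^-1 * dg _]mulrC [_ * (B / _)]mulrC.
  have -> : `|N%:R^-1 : K| = N%:R^-1 by rewrite ger0_norm ?invr_ge0 ?ler0n.
  apply => t t01; have t0 : 0 <= t by case/andP: t01.
  have [dgt -> _ _] := gB _ (in01 k t t01); split=> //.
  have := @segment_mean_value _ HK _ dg (k%:R / N%:R) 1 (t * N%:R^-1) 0 B.
  rewrite scale mulr0 subr0 => H; apply: le_trans (H _) _.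
    move=> s /andP[s0 s1].
    have st : 0 <= s * t <= 1.
      by case/andP: t01 => _ t1; rewrite mulr_ge0 //= mulr_ile1.
    have [_ _ d2 Bd] := gB _ (in01 k _ st).
    by rewrite subr0 /GRing.scale /= mulrA.
  rewrite ger0_norm ?divr_ge0 ?ler0n // mulrC ler_wpM2l // ler_piMl ?invr_ge0 ?ler0n //.
  by case/andP: t01.
have -> : g 1 - g 0 = \sum_(k < N) (g (k%:R / N%:R + N%:R^-1) - g (k%:R / N%:R)).
  have := telescope_sumr (fun k => g (k%:R / N%:R)) (leq0n N).
  rewrite mul0r divff ?gt_eqF // => <-; rewrite big_mkord.
  by apply: eq_bigr => k _; rewrite -natr1 mulrDl mul1r.
rewrite -sumrB.
apply: le_trans (ler_norm_sum _ _ _) _.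
apply: (@le_trans _ _ (\sum_(k < N) B / N%:R / N%:R)).
  by apply: ler_sum => k _; rewrite distrC; exact: step.
rewrite sumr_const card_ord -[_ *+ N]mulr_natr.
by rewrite mulfVK ?gt_eqF.
Qed.

Lemma derive_affine {V W : normedModType K} (f : W -> K) (l : {linear V -> W})
    (w : W) (q u : V) :
  continuous l -> differentiable f (w + l q) ->
  differentiable (fun x => f (w + l x)) q /\
  'D_u (fun x => f (w + l x)) q = 'D_(l u) f (w + l q).
Proof.
move=> lc df; pose m (x : V) := w + l x.
have dm : is_diff q m l.
  have dl : is_diff q l l.
    by apply: DiffDef; [exact: linear_differentiable|exact: diff_lin].
  by have := is_diffD (is_diff_cst w q) dl; rewrite add0r.
have dmq : differentiable m q by exact: ex_diff.
split; first exact: (differentiable_comp dmq df).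
rewrite -[LHS]/('D_u (f \o m) q) (derive_comp u dmq df).
by rewrite (deriveE u dmq) (diff_val (is_diff_def := dm)).
Qed.

Lemma derive_ray {V : normedModType K} (f : V -> K) (p v : V) (t : K) :
  differentiable f (p + t *: v) ->
  differentiable (fun s : K => f (p + s *: v)) t /\
  'D_1 (fun s : K => f (p + s *: v)) t = 'D_v f (p + t *: v).
Proof.
move=> df; pose m (s : K) := p + s *: v.
have dm : is_diff t m ( *:%R^~ v).
  by have := is_diffD (is_diff_cst p t) (is_diff_scalel t v); rewrite add0r.
have dmq : differentiable m t by exact: ex_diff.
split; first exact: (differentiable_comp dmq df).
rewrite -[LHS]/('D_1 (f \o m) t) (derive_comp (1 : K) dmq df).
by rewrite (deriveE (1 : K) dmq) (diff_val (is_diff_def := dm)) scale1r.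
Qed.

(** Consecutive [F n] agree at [c] and have close partial derivatives, hence converge geometrically
    on the ball. Differentiability of the limit follows from the first-order estimate for [F n] at a
    fixed increment [h], letting [n] grow. *)
Lemma uniform_limit_primitive (F : nat -> plane K -> K) (w1 w2 : plane K -> K)
    (c : plane K) (r C : K) :
  0 < r -> 0 <= C ->
  (forall q, ball c r q -> {for q, continuous w1} /\ {for q, continuous w2}) ->
  (forall n, F n c = 0) ->
  (forall n q, ball c r q -> [/\ differentiable (F n) q,
     `|d_x (F n) q - w1 q| <= C / 2 ^+ n & `|d_y (F n) q - w2 q| <= C / 2 ^+ n]) ->
  exists G : plane K -> K, forall q, ball c r q ->
    [/\ differentiable G q, d_x G q = w1 q & d_y G q = w2 q].
Proof.
move=> r0 C0 cw Fc FC.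
have bc : ball c r c by rewrite ballE subrr normr0.
have Cn n : 0 <= C / 2 ^+ n by rewrite divr_ge0 ?exprn_ge0.
(* The factor 2 of [ball_mean_value], the bound [2 * C] (up to [2 ^+ n]) on the partial derivatives
   of [F n.+1 - F n], and the distance [r] to the centre. *)
pose D := 2 * (2 * C) * r.
have cauchy q : ball c r q -> forall n, `|F n.+1 q - F n q| <= D / 2 ^+ n.
  move=> qr n; have := @ball_mean_value _ HK (fun x => F n.+1 x - F n x) c r 0 0
    (2 * C / 2 ^+ n).
  have H : forall q0, ball c r q0 -> [/\ differentiable (fun x => F n.+1 x - F n x) q0,
      `|d_x (fun x => F n.+1 x - F n x) q0 - 0| <= 2 * C / 2 ^+ n
    & `|d_y (fun x => F n.+1 x - F n x) q0 - 0| <= 2 * C / 2 ^+ n].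
    move=> x xr; have [d0 x0 y0] := FC n x xr; have [d1 x1 y1] := FC n.+1 x xr.
    have dB u : 'D_u (fun x => F n.+1 x - F n x) x = 'D_u (F n.+1) x - 'D_u (F n) x.
      by apply: (@deriveB _ _ _ (F n.+1) (F n)); exact: diff_derivable.
    have bound (a b z : K) : `|a - z| <= C / 2 ^+ n.+1 -> `|b - z| <= C / 2 ^+ n ->
        `|a - b - 0| <= 2 * C / 2 ^+ n.
      move=> az bz; rewrite subr0 -(subrKA z).
      apply: le_trans (ler_normD _ _) _; rewrite [`|z - b|]distrC -mulrA mulr_natl mulr2n.
      apply: lerD => //; apply: le_trans az _.
      by rewrite ler_wpM2l // lef_pV2 ?posrE ?exprn_gt0 // ler_eXn2l ?ltr1n.
    split; first exact: (differentiableB d1 d0).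
      by rewrite /d_x dB; exact: bound x1 x0.
    by rewrite /d_y dB; exact: bound y1 y0.
  move=> /(_ H c q bc qr); rewrite !Fc subr0 subr0.
  rewrite /lin2 !mul0r addr0 subr0 => /le_trans; apply.
  have -> : D / 2 ^+ n = 2 * (2 * C / 2 ^+ n) * r by rewrite /D; ring.
  have C2 : 0 <= 2 * (2 * C / 2 ^+ n) by rewrite -mulrA mulr_ge0 // mulr_ge0.
  by move: qr; rewrite ballE => /ltW; exact: ler_wpM2l.
have [G GP] : exists G : plane K -> K, forall q, ball c r q ->
    forall n, `|F n q - G q| <= 4 * D / 2 ^+ n.
  have ex q : exists l, ball c r q -> forall n, `|F n q - l| <= 4 * D / 2 ^+ n.
    have [qr|nqr] := pselect (ball c r q); last by exists 0.
    by have [l lP] := geometric_cvg HK (cauchy q qr); exists l.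
  by exists (fun q => projT1 (cid (ex q))) => q; exact: (projT2 (cid (ex q))).
exists G => q qr; have [cw1 cw2] := cw q qr.
have D0 : 0 <= D by rewrite !mulr_ge0 // ltW.
have := @differentiable_approx _ _ _ (lin2 (w1 q) (w2 q)) G q (@lin2_continuous _ _ _).
case=> [e e0|dG DG]; last first.
  by split=> //; rewrite /d_x /d_y DG /= /lin2 /= mulr1 mulr0 ?addr0 ?add0r.
have e4 : 0 < e / 4 by rewrite divr_gt0.
have nq : \forall x \near q, ball c r x.
  by apply: open_nbhs_nbhs; split=> //; exact: ball_open.
have [d /andP[d0 _] dP] := near_ball (filterI nq (filterI
  (near_norm_le cw1 e4) (near_norm_le cw2 e4))).
have n0 : \forall h \near (0 : plane K), ball (0 : plane K) d h by exact: nbhsx_ballx.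
apply: filterS n0 => h; rewrite ballE subr0 => hd.
have bq : ball q d q by rewrite ballE subrr normr0.
have bhq : ball q d (h + q) by rewrite ballE addrK.
have hr : ball c r (h + q) by have [] := dP _ bhq.
(* The part of the error that depends on [n]: [8 * D] from replacing [G] by [F n] at two points,
   [2 * C * |h|] from the partial derivatives of [F n]. *)
apply: (@le_of_pow2 _ HK _ _ (8 * D + 2 * C * `|h|)).
  by apply: addr_ge0; apply: mulr_ge0 => //; exact: mulr_ge0.
move=> n.
have Fn : `|F n (h + q) - F n q - lin2 (w1 q) (w2 q) (h + q - q)|
    <= 2 * (e / 4 + C / 2 ^+ n) * `|h + q - q|.
  apply: (@ball_mean_value _ HK _ q d) => // x xd.
  have [xr [x1 x2]] := dP x xd; have [dF Fx Fy] := FC n x xr.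
  have tri (a b z : K) : `|a - b| <= C / 2 ^+ n -> `|b - z| <= e / 4 ->
      `|a - z| <= e / 4 + C / 2 ^+ n.
    move=> ab bz; rewrite [e / 4 + _]addrC -(subrKA b).
    exact: le_trans (ler_normD _ _) (lerD ab bz).
  by split=> //; [exact: tri Fx x1|exact: tri Fy x2].
rewrite addrK in Fn.
have -> : G (h + q) - G q - lin2 (w1 q) (w2 q) h =
    (F n (h + q) - F n q - lin2 (w1 q) (w2 q) h)
    - ((F n (h + q) - G (h + q)) - (F n q - G q)) by ring.
apply: le_trans (ler_normB _ _) _.
apply: le_trans (lerD Fn (le_trans (ler_normB _ _) (lerD (GP _ hr n) (GP _ qr n)))) _.
have -> : 2 * (e / 4 + C / 2 ^+ n) * `|h| + (4 * D / 2 ^+ n + 4 * D / 2 ^+ n) =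
  e / 2 * `|h| + (8 * D + 2 * C * `|h|) / 2 ^+ n by field; rewrite expf_eq0 pnatr_eq0 andbF.
rewrite lerD2r ler_wpM2r // ler_pdivrMr // ler_peMr ?ler1n //.
exact: ltW.
Qed.

End Primitive.

Section Poincare.
Context {K : numFieldType} (HK : calculus_field K).

Lemma locally_bounded {V : normedModType K} (f : V -> K) (p : V) :
  {for p, continuous f} ->
  exists2 B : K, 0 <= B & \forall q \near p, `|f q| <= B.
Proof.
move=> cf; exists (`|f p| + 1); first by rewrite addr_ge0.
apply: filterS (near_norm_le cf ltr01) => q fq.
rewrite -(subrK (f p) (f q)) addrC.
by apply: le_trans (ler_normD _ _) _; rewrite lerD2l.
Qed.

(** The bound is uniform in the direction, as the rays from a centre require; it is built from the
    two partial derivatives. *)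
Lemma derive_bounded (f : plane K -> K) (A : set (plane K)) (p : plane K) :
  open A -> A p -> class_C 1 A f ->
  exists2 C : K, 0 <= C & \forall q \near p, forall v : plane K,
    `|v| <= 1 -> `|'D_v f q| <= C.
Proof.
move=> oA Ap [df Cf].
have [B1 B10 n1] := locally_bounded (Cf (1, 0) p Ap).
have [B2 B20 n2] := locally_bounded (Cf (0, 1) p Ap).
have B0 : 0 <= 2 * (B1 + B2) by rewrite mulr_ge0 // addr_ge0.
exists (2 * (B1 + B2)) => //.
have nA := open_nbhs_nbhs (conj oA Ap).
apply: filterS (filterI nA (filterI n1 n2)) => q [Aq [q1 q2]] v v1.
rewrite derive_lin2; last exact: df.
apply: le_trans (norm_lin2_le (M := B1 + B2) _ _ _) _.
- by apply: le_trans q1 _; rewrite lerDl.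
- by apply: le_trans q2 _; rewrite lerDr.
- exact: ler_piMr.
Qed.

Lemma second_derive_bounded (f : plane K -> K) (A : set (plane K)) (p : plane K) :
  open A -> A p -> class_C 2 A f ->
  exists2 C : K, 0 <= C & \forall q \near p, forall v : plane K,
    `|v| <= 1 -> `|'D_v f q| <= C /\ `|'D_v ('D_v f) q| <= C.
Proof.
move=> oA Ap Cf; have [df Df] := Cf.
have [B0 B00 n0] := derive_bounded oA Ap (class_CS Cf).
have [B1 B10 n1] := derive_bounded oA Ap (Df (1, 0)).
have [B2 B20 n2] := derive_bounded oA Ap (Df (0, 1)).
have B12 : 0 <= 2 * (B1 + B2) by rewrite mulr_ge0 // addr_ge0.
exists (B0 + 2 * (B1 + B2)); first exact: addr_ge0.
have nA := open_nbhs_nbhs (conj oA Ap).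
apply: filterS (filterI nA (filterI n0 (filterI n1 n2))) => q [Aq [q0 [q1 q2]]] v v1.
split; first by apply: le_trans (q0 v v1) _; rewrite lerDl.
have [d1 _] := Df (1, 0); have [d2 _] := Df (0, 1).
have -> : 'D_v ('D_v f) q = lin2 ('D_v (d_x f) q) ('D_v (d_y f) q) v.
  have -> : 'D_v ('D_v f) q = 'D_v (v.1 *: d_x f + v.2 *: d_y f) q.
    apply: near_eq_derive; apply: filterS (open_nbhs_nbhs (conj oA Aq)) => x Ax.
    by rewrite derive_plane //; exact: df.
  have e1 : derivable (d_x f) q v by apply: diff_derivable; exact: d1.
  have e2 : derivable (d_y f) q v by apply: diff_derivable; exact: d2.
  rewrite deriveD; [|exact: derivableZ|exact: derivableZ].
  rewrite (deriveZ v.1 e1) (deriveZ v.2 e2).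
  by move: ('D_v (d_x f) q) ('D_v (d_y f) q) => a b; rewrite /lin2 mulrC [b * _]mulrC.
apply: le_trans (norm_lin2_le (M := B1 + B2) _ _ _) _.
- by apply: le_trans (q1 v v1) _; rewrite lerDl.
- by apply: le_trans (q2 v v1) _; rewrite lerDr.
- by apply: le_trans (ler_piMr B12 v1) _; rewrite lerDr.
Qed.

(** For [F t = w (c + t v)] with derivative [G], the function [F + s G] is the integrand to which
    closedness leads, and [s F] is its primitive; both derivatives are needed by [riemann_sum]. *)
Lemma derive_mul_id (F G : K -> K) (t : K) :
  differentiable F t -> 'D_1 F t = G t -> differentiable G t ->
  [/\ differentiable (fun s : K => s * F s) t,
      'D_1 (fun s : K => s * F s) t = F t + t * G t,
      differentiable (fun s : K => F s + s * G s) t &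
      'D_1 (fun s : K => F s + s * G s) t = G t + (G t + t * 'D_1 G t)].
Proof.
move=> dF DF dG.
have did : differentiable (id : K -> K) t by [].
have Did : 'D_1 (id : K -> K) t = 1 by exact: derive_id.
have prod (H : K -> K) : differentiable H t ->
    differentiable (fun s : K => s * H s) t /\
    'D_1 (fun s : K => s * H s) t = H t + t * 'D_1 H t.
  move=> dH; split; first exact: (differentiableM did dH).
  rewrite (@deriveM _ _ (id : K -> K) H); try exact: diff_derivable.
  by rewrite Did addrC /GRing.scale /= mulr1.
have [dg0 Dg0] := prod _ dF; have [dg1 Dg1] := prod _ dG.
split; [exact: dg0|by rewrite Dg0 DF|exact: (differentiableD dF dg1)|].
rewrite -{1}DF -Dg1; apply: (@deriveD _ _ _ F (fun s : K => s * G s));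
  exact: diff_derivable.
Qed.

Lemma norm_three_le (a b t C : K) : `|a| <= C -> `|b| <= C -> 0 <= t <= 1 ->
  `|a + (a + t * b)| <= 3 * C.
Proof.
move=> aC bC /andP[t0 t1]; have -> : 3 * C = C + (C + C) by ring.
apply: le_trans (ler_normD _ _) (lerD aC _).
apply: le_trans (ler_normD _ _) (lerD aC _).
by rewrite normrM ger0_norm //; apply: le_trans bC; rewrite ler_piMl.
Qed.

(** The sum is a Riemann sum for the integral of [d/dt (t * f (c + t (p - c)))] over the unit
    interval, which is [f p]. The condition [r <= 1] makes the direction [p - c] admissible in the
    bounds, and 3 counts the terms of the second derivative. *)
Lemma ray_sum (f : plane K -> K) (A : set (plane K)) (c p : plane K) (r C : K)
    (N : nat) :
  class_C 2 A f -> r <= 1 -> (0 < N)%N ->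
  (forall q, ball c r q -> A q /\ forall v : plane K, `|v| <= 1 ->
     `|'D_v f q| <= C /\ `|'D_v ('D_v f) q| <= C) ->
  ball c r p ->
  `|\sum_(k < N) (f (c + (k%:R / N%:R) *: (p - c))
       + k%:R / N%:R * 'D_(p - c) f (c + (k%:R / N%:R) *: (p - c))) / N%:R - f p|
    <= 3 * C / N%:R.
Proof.
move=> [df Df] r1 N0 fC pr.
have r0 : 0 < r by apply: le_lt_trans (normr_ge0 (p - c)) _; rewrite -ballE.
have cr : ball c r c by rewrite ballE subrr normr0.
set v := p - c.
have v1 : `|v| <= 1 by apply: ltW; apply: lt_le_trans r1; rewrite -ballE.
pose F (t : K) := f (c + t *: v); pose G (t : K) := 'D_v f (c + t *: v).
have := @riemann_sum _ HK (fun s : K => s * F s) (fun s : K => F s + s * G s) (3 * C) N N0.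
have -> : F 1 = f p by rewrite /F scale1r subrKC.
rewrite mul0r subr0 mul1r; apply => t t01.
have [Aq /(_ v v1) [D1 D2]] := fC _ (ball_segment cr pr t01).
rewrite -/v in Aq D1 D2.
have [dDf _] := Df v.
have [d1 e1] := derive_ray (df _ Aq); have [d2 e2] := derive_ray (dDf _ Aq).
have [dg0 Dg0 dg1 Dg1] := @derive_mul_id F G t d1 e1 d2.
split; [exact: dg0|exact: Dg0|exact: dg1|rewrite Dg1].
have GC : `|G t| <= C by exact: D1.
have DGC : `|'D_1 G t| <= C by rewrite (_ : 'D_1 G t = 'D_v ('D_v f) (c + t *: v)).
exact: norm_three_le.
Qed.

Lemma derive_dot {V : normedModType K} (a1 a2 b1 b2 : V -> K) (q : V) :
  differentiable a1 q -> differentiable b1 q ->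
  differentiable a2 q -> differentiable b2 q ->
  differentiable (fun p => a1 p * b1 p + a2 p * b2 p) q /\
  forall u, 'D_u (fun p => a1 p * b1 p + a2 p * b2 p) q =
    a1 q * 'D_u b1 q + b1 q * 'D_u a1 q + (a2 q * 'D_u b2 q + b2 q * 'D_u a2 q).
Proof.
move=> da1 db1 da2 db2.
have d1 := differentiableM da1 db1; have d2 := differentiableM da2 db2.
split=> [|u]; first exact: (differentiableD d1 d2).
rewrite (@deriveD _ _ _ (a1 * b1) (a2 * b2)); try exact: diff_derivable.
by rewrite !deriveM; try exact: diff_derivable.
Qed.

Lemma derive_homothety {V : normedModType K} (f : V -> K) (w q : V) (t : K) :
  differentiable f (w + t *: q) ->
  differentiable (fun x => f (w + t *: x)) q /\
  forall u, 'D_u (fun x => f (w + t *: x)) q = t * 'D_u f (w + t *: q).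
Proof.
move=> df.
have tc : continuous ( *:%R t : V -> V) by exact: scaler_continuous.
have D u := derive_affine u tc df; split=> [|u]; first by have [] := D 0.
by rewrite (D u).2 deriveE // linearZ -deriveE.
Qed.

Lemma derive_mean {V : normedModType K} (n : nat) (h : 'I_n -> V -> K) (m : K)
    (q : V) :
  (forall k, differentiable (h k) q) ->
  differentiable (fun p => \sum_(k < n) h k p / m) q /\
  forall u, 'D_u (fun p => \sum_(k < n) h k p / m) q = \sum_(k < n) 'D_u (h k) q / m.
Proof.
move=> dh.
have dhm k : differentiable (fun p => h k p * m^-1) q.
  exact: (differentiableM (dh k) (differentiable_cst _ q)).
have -> : (fun p => \sum_(k < n) h k p / m) = \sum_(k < n) (fun p => h k p * m^-1).
  by apply/funext => p; rewrite fct_sumE.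
split=> [|u]; first exact: differentiable_sum.
rewrite derive_sum => [|k]; last exact: diff_derivable.
apply: eq_bigr => k _.
have := @deriveMr _ _ (h k) m^-1 q u (diff_derivable (v := u) (dh k)).
by rewrite /GRing.scale /= mulrC.
Qed.

(* The primitive is the limit of the Riemann sums of the form along the segments
   from [c]. Closedness turns their partial derivatives into Riemann sums of
   [d/dt (t * wi (c + t (p - c)))], which converge to [wi p]. *)
Lemma closed_exact (w1 w2 : plane K -> K) (A : set (plane K)) (c : plane K) :
  open A -> A c -> class_C 2 A w1 -> class_C 2 A w2 ->
  (forall q, A q -> d_y w1 q = d_x w2 q) ->
  exists2 r : K, 0 < r & exists F : plane K -> K, forall q, ball c r q ->
    [/\ A q, differentiable F q, d_x F q = w1 q & d_y F q = w2 q].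
Proof.
move=> oA Ac C1 C2 closed.
have [B1 B10 n1] := second_derive_bounded oA Ac C1.
have [B2 B20 n2] := second_derive_bounded oA Ac C2.
have nA := open_nbhs_nbhs (conj oA Ac).
have [r /andP[r0 r1] rP] := near_ball (filterI nA (filterI n1 n2)).
exists r => //.
have [d1 _] := C1; have [d2 _] := C2.
(* The point [c + t (p - c)], written as a constant plus [t *: p] so that [derive_homothety]
   applies. *)
pose gam (t : K) (p : plane K) := (c - t *: c) + t *: p.
have gamE t p : gam t p = c + t *: (p - c).
  by rewrite /gam scalerBr addrAC addrA.
have cr : ball c r c by rewrite ballE subrr normr0.
(* The integrand of the line integral of the form along the segment from [c] to [p]. *)
pose T (t : K) (p : plane K) :=
  w1 (gam t p) * (p.1 - c.1) + w2 (gam t p) * (p.2 - c.2).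
have TP (t : K) (q : plane K) : 0 <= t <= 1 -> ball c r q ->
    [/\ differentiable (T t) q,
        d_x (T t) q = w1 (c + t *: (q - c)) + t * 'D_(q - c) w1 (c + t *: (q - c)) &
        d_y (T t) q = w2 (c + t *: (q - c)) + t * 'D_(q - c) w2 (c + t *: (q - c))].
  move=> t01 qr; have [Aq _] := rP _ (ball_segment cr qr t01).
  move: (Aq); rewrite -gamE => Ag.
  have E1 := derive_homothety (d1 _ Ag); have E2 := derive_homothety (d2 _ Ag).
  have E3 (i : {linear plane K -> K}) : continuous i ->
      differentiable (fun p : plane K => i p - i c) q /\
      forall u, 'D_u (fun p : plane K => i p - i c) q = i u.
    move=> ic.
    have di : is_diff q i i.
      by apply: DiffDef; [exact: linear_differentiable|exact: diff_lin].
    have dB := is_diffB di (is_diff_cst (i c) q).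
    have dBq : differentiable (fun p : plane K => i p - i c) q by exact: ex_diff.
    split=> // u; rewrite deriveE // (diff_val (is_diff_def := dB)).
    by rewrite subr0.
  have [dx Dx] := E3 (@fst K K) fst_continuous.
  have [dy Dy] := E3 (@snd K K) snd_continuous.
  have [g1 Dg1] := E1; have [g2 Dg2] := E2.
  have [dT DT'] := derive_dot g1 dx g2 dy.
  have DT u : 'D_u (T t) q = w1 (gam t q) * u.1 + w2 (gam t q) * u.2 +
      t * ((q.1 - c.1) * 'D_u w1 (gam t q) + (q.2 - c.2) * 'D_u w2 (gam t q)).
    rewrite -[LHS]/('D_u (fun p => w1 (gam t p) * (p.1 - c.1) + w2 (gam t p) * (p.2 - c.2)) q).
    rewrite DT' Dg1 Dg2 Dx Dy -!/(gam t q).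
    by move: ('D_u w1 _) ('D_u w2 _) (w1 _) (w2 _) => a b a' b'; ring.
  have Dw1 := derive_lin2 (q - c) (d1 _ Ag); have Dw2 := derive_lin2 (q - c) (d2 _ Ag).
  split; [exact: dT| |].
    (* Closedness exchanges [d_y w1] and [d_x w2], which turns the partial derivative of the
       integrand into a derivative along the ray. *)
    rewrite [LHS]DT Dw1 (closed _ Ag) /lin2 /d_x /=.
    by move: ('D_(1, 0) w1 _) ('D_(1, 0) w2 _) => a b; ring.
  rewrite [LHS]DT Dw2 -(closed _ Ag) /lin2 /d_y /=.
  by move: ('D_(0, 1) w1 _) ('D_(0, 1) w2 _) => a b; ring.
(* With [2 ^ n] pieces the error of the Riemann sums has the form required by
   [uniform_limit_primitive]. *)
pose N n := (2 ^ n)%N.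
have N0 n : (0 < N n)%N by rewrite expn_gt0.
have NE n : (N n)%:R = 2 ^+ n :> K by rewrite natrX.
pose F n (p : plane K) := \sum_(k < N n) T (k%:R / (N n)%:R) p / (N n)%:R.
have k01 n (k : 'I_(N n)) : 0 <= (k%:R / (N n)%:R : K) <= 1.
  rewrite divr_ge0 ?ler0n //= ler_pdivrMr ?ltr0n // mul1r ler_nat.
  exact: ltnW.
suff [G GP] : exists G : plane K -> K, forall q, ball c r q ->
    [/\ differentiable G q, d_x G q = w1 q & d_y G q = w2 q].
  by exists G => q qr; have [] := GP q qr; have [] := rP q qr.
apply: (@uniform_limit_primitive _ HK F w1 w2 c r (3 * (B1 + B2))) => //.
- by rewrite mulr_ge0 // addr_ge0.
- move=> q /rP[Aq _]; split; apply: differentiable_continuous;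
    [exact: d1|exact: d2].
- move=> n; rewrite /F big1 // => k _.
  by rewrite /T !subrr !mulr0 addr0 mul0r.
move=> n q qr.
have Tk (k : 'I_(N n)) := TP _ q (k01 n k) qr.
have dT (k : 'I_(N n)) : differentiable (T (k%:R / (N n)%:R)) q by have [] := Tk k.
have [dF DF] := derive_mean (N n)%:R dT.
have b1 : forall x, ball c r x -> A x /\ forall v : plane K, `|v| <= 1 ->
    `|'D_v w1 x| <= B1 + B2 /\ `|'D_v ('D_v w1) x| <= B1 + B2.
  move=> x /rP[Ax [x1 _]]; split=> // v v1; have [y1 y2] := x1 v v1.
  by split; [apply: le_trans y1 _|apply: le_trans y2 _]; rewrite lerDl.
have b2 : forall x, ball c r x -> A x /\ forall v : plane K, `|v| <= 1 ->
    `|'D_v w2 x| <= B1 + B2 /\ `|'D_v ('D_v w2) x| <= B1 + B2.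
  move=> x /rP[Ax [_ x1]]; split=> // v v1; have [y1 y2] := x1 v v1.
  by split; [apply: le_trans y1 _|apply: le_trans y2 _]; rewrite lerDr.
have := ray_sum C1 r1 (N0 n) b1 qr; have := ray_sum C2 r1 (N0 n) b2 qr.
rewrite -NE => R2 R1.
split; first exact: dF.
- rewrite [d_x _ _]DF; apply: le_trans R1; rewrite le_eqVlt; apply/orP; left.
  apply/eqP; congr (`|_ - _|); apply: eq_bigr => k _.
  by have [_ <- _] := Tk k.
- rewrite [d_y _ _]DF; apply: le_trans R2; rewrite le_eqVlt; apply/orP; left.
  apply/eqP; congr (`|_ - _|); apply: eq_bigr => k _.
  by have [_ _ <-] := Tk k.
Qed.

End Poincare.

(** * Inverse function theorem *)

Section Picard.
Context {K : numFieldType} (HK : calculus_field K).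

(** The triangle inequality both ways; the lower bound yields injectivity and a Lipschitz
    inverse. *)
Lemma near_identity_lipschitz (H : plane K -> plane K) (x x' : plane K) :
  `|H x' - H x - (x' - x)| <= 2^-1 * `|x' - x| ->
  `|H x' - H x| <= 2 * `|x' - x| /\ `|x' - x| <= 2 * `|H x' - H x|.
Proof.
move=> Hx.
have half (a : K) : a = 2^-1 * a + 2^-1 * a by field.
have n0 := normr_ge0 (x' - x).
split.
  rewrite -[H x' - H x](subrK (x' - x)); apply: le_trans (ler_normD _ _) _.
  rewrite mulr_natl mulr2n lerD2r; apply: le_trans Hx _.
  by rewrite ler_piMl // invf_le1 // ler1n.
have : `|x' - x| <= `|H x' - H x| + 2^-1 * `|x' - x|.
  rewrite -{1}[x' - x](subKr (H x' - H x)); apply: le_trans (ler_normB _ _) _.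
  by rewrite lerD2l.
rewrite {1}[`|x' - x|]half lerD2r => /(ler_wpM2l (ler0n K 2)).
by rewrite mulrA divff ?mul1r // pnatr_eq0.
Qed.

(** Picard iteration of [x - H x + y] from [c]: the first step has length [d], each later one at
    most half the preceding, so the total displacement is at most [2 * d < r]. *)
Lemma near_identity_surjective (H : plane K -> plane K) (c y : plane K) (r : K) :
  (forall x x', ball c r x -> ball c r x' ->
     `|H x' - H x - (x' - x)| <= 2^-1 * `|x' - x|) ->
  2 * `|y - H c| < r ->
  exists2 x, ball c r x & H x = y.
Proof.
move=> Hr; set d := `|y - H c| => dr.
have d0 : 0 <= d by exact: normr_ge0.
pose e x := x - H x + y.
have cancel (a b : plane K) : a - b + y - a = y - b.
  by rewrite addrC !addrA addNr add0r addrC.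
pose x n := iter n e c.
have half n : d / 2 ^+ n = 2 * (d / 2 ^+ n.+1).
  by rewrite exprS; field; rewrite expf_eq0 pnatr_eq0 andbF.
have dn n : 0 <= d / 2 ^+ n by rewrite divr_ge0 ?exprn_ge0.
have in_r z n : `|z - c| <= 2 * d - 2 * (d / 2 ^+ n) -> ball c r z.
  move=> zc; rewrite ballE; apply: le_lt_trans zc _; apply: le_lt_trans dr.
  by rewrite gerBl mulr_ge0.
(* The two bounds go together: the contraction estimate applies only while the iterates stay in the
   ball. *)
have step n : `|x n.+1 - x n| <= d / 2 ^+ n /\ `|x n - c| <= 2 * d - 2 * (d / 2 ^+ n).
  elim: n => [|n [IH1 IH2]].
    rewrite /x /= /e expr0 divr1 subrr subrr normr0; split=> //.
    by rewrite cancel.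
  have xS : `|x n.+1 - c| <= 2 * d - 2 * (d / 2 ^+ n.+1).
    rewrite -(subrKA (x n)); apply: le_trans (ler_normD _ _) _.
    apply: le_trans (lerD IH1 IH2) _; rewrite -half.
    rewrite le_eqVlt; apply/orP; left; apply/eqP; ring.
  split=> //.
  have -> : x n.+2 - x n.+1 = - (H (x n.+1) - H (x n) - (x n.+1 - x n)).
    rewrite -[x n.+2]/(x n.+1 - H (x n.+1) + y).
    rewrite -[X in _ - X]/(x n - H (x n) + y).
    by rewrite opprD addrACA subrr addr0 !opprD !opprK addrACA [RHS]addrC.
  rewrite normrN; apply: le_trans (Hr _ _ (in_r _ _ IH2) (in_r _ _ xS)) _.
  by rewrite exprS invfM mulrCA ler_wpM2l // invr_ge0.
have [l1 l1P] := geometric_cvg HK (fun n => le_trans (norm_fst_le (x n.+1 - x n)) (step n).1).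
have [l2 l2P] := geometric_cvg HK (fun n => le_trans (norm_snd_le (x n.+1 - x n)) (step n).1).
pose l : plane K := (l1, l2).
have lP n : `|l - x n| <= 4 * d / 2 ^+ n.
  by rewrite distrC; apply: plane_norm_le; [exact: l1P|exact: l2P].
have lr : ball c r l.
  rewrite ballE; apply: le_lt_trans dr; apply: (@le_of_pow2 _ HK _ _ (4 * d)).
    by rewrite mulr_ge0.
  move=> n; rewrite [2 * d + _]addrC -(subrKA (x n));
  apply: le_trans (ler_normD _ _) (lerD (lP n) _).
  by apply: le_trans (step n).2 _; rewrite gerBl mulr_ge0.
exists l => //; apply/eqP; rewrite -subr_eq0 -normr_le0.
(* The 9 is [2 * 4 + 1]: Lipschitz constant times distance of [x n] to the limit, plus one step of
   the iteration. *)
apply: (@le_of_pow2 _ HK _ _ (9 * d)); first by rewrite mulr_ge0.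
move=> n; rewrite add0r.
have [xn xnc] := step n.
have [Hl _] := near_identity_lipschitz (Hr _ _ (in_r _ _ xnc) lr).
have -> : H l - y = (H l - H (x n)) - (x n.+1 - x n).
  by rewrite -[x n.+1]/(x n - H (x n) + y) cancel opprB addrA subrK.
apply: le_trans (ler_normB _ _) _; apply: le_trans (lerD Hl xn) _.
have -> : 9 * d / 2 ^+ n = 2 * (4 * d / 2 ^+ n) + d / 2 ^+ n by ring.
by rewrite lerD2r ler_wpM2l.
Qed.

Lemma class_C_lin2 n (A : set (plane K)) (f g : plane K -> K) (v : plane K) :
  open A -> class_C n A f -> class_C n A g ->
  class_C n A (fun x => lin2 (f x) (g x) v).
Proof.
move=> oA Cf Cg; apply: class_C_add => //; apply: class_C_mul => //;
  exact: class_C_cst.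
Qed.

(** Expand [(h1, h2)] to first order at [x], invert the Jacobian matrix by Cramer's rule, and use
    the Lipschitz bound on [psi] to make the remainder small against the increment of [y]. *)
Lemma derive_inverse (h1 h2 : plane K -> K) (psi : plane K -> plane K)
    (V : set (plane K)) (y : plane K) :
  let x := psi y in
  let J := d_x h1 x * d_y h2 x - d_y h1 x * d_x h2 x in
  open V -> V y ->
  (forall z, V z -> (h1 (psi z), h2 (psi z)) = z) ->
  (forall z z', V z -> V z' -> `|psi z - psi z'| <= 2 * `|z - z'|) ->
  differentiable h1 x -> differentiable h2 x -> J != 0 ->
  [/\ differentiable (fst \o psi) y, differentiable (snd \o psi) y &
    forall v, 'D_v (fst \o psi) y = lin2 (d_y h2 x / J) (- d_y h1 x / J) v /\
              'D_v (snd \o psi) y = lin2 (- d_x h2 x / J) (d_x h1 x / J) v].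
Proof.
move=> x J oV Vy psiK lip dh1 dh2 J0.
set a := d_x h1 x in J J0 *; set b := d_y h1 x in J J0 *.
set c := d_x h2 x in J J0 *; set d := d_y h2 x in J J0 *.
(* Here [k] is the differential at the increment of [psi], plus [rho]. That increment is at most
   [2 * |k|], so tolerance [e / 2] upstairs becomes [e] in terms of [k]. *)
have key (e : K) : 0 < e -> \forall k \near (0 : plane K),
    exists rho : plane K, [/\ `|rho| <= e * `|k|,
      k.1 = lin2 a b (psi (k + y) - psi y) + rho.1 &
      k.2 = lin2 c d (psi (k + y) - psi y) + rho.2].
  move=> e0; have e2 : 0 < e / 2 by rewrite divr_gt0.
  have [r /andP[r0 _] rP] := near_ball
    (filterI (diff_approx dh1 e2) (diff_approx dh2 e2)).
  have nV : \forall k \near (0 : plane K), V (k + y).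
    have := open_nbhs_nbhs (conj oV Vy).
    by rewrite -[nbhs y V]/(\forall z \near y, V z) (near_shift 0 y) /= subr0.
  have n0 : \forall k \near (0 : plane K), ball (0 : plane K) (r / 2) k.
    by apply: nbhsx_ballx; rewrite divr_gt0.
  apply: filterS (filterI nV n0) => k [Vk]; rewrite ballE subr0 => kr.
  set h := psi (k + y) - psi y.
  have hk : `|h| <= 2 * `|k| by have := lip _ _ Vk Vy; rewrite addrK.
  have hr : ball 0 r h.
    rewrite ballE subr0; apply: le_lt_trans hk _.
    by rewrite mulrC -ltr_pdivlMr.
  have hx : h + x = psi (k + y) by rewrite subrK.
  have [r1 r2] := rP h hr; rewrite hx (derive_lin2 h dh1) (derive_lin2 h dh2) in r1 r2.
  have E1 := psiK _ Vk; have E0 := psiK _ Vy.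
  have k1 : h1 (psi (k + y)) - h1 x = k.1.
    by rewrite -[X in X - _]/((h1 (psi (k + y)), h2 (psi (k + y))).1) E1
      -[X in _ - X]/((h1 (psi y), h2 (psi y)).1) E0 /= addrK.
  have k2 : h2 (psi (k + y)) - h2 x = k.2.
    by rewrite -[X in X - _]/((h1 (psi (k + y)), h2 (psi (k + y))).2) E1
      -[X in _ - X]/((h1 (psi y), h2 (psi y)).2) E0 /= addrK.
  rewrite k1 k2 in r1 r2.
  exists (k.1 - lin2 a b h, k.2 - lin2 c d h); split => /=;
    rewrite ?[lin2 _ _ _ + _]addrC ?subrK //.
  have eh : e / 2 * `|h| <= e * `|k|.
    have -> : e * `|k| = e / 2 * (2 * `|k|) by field.
    by rewrite ler_wpM2l // ltW.
  by apply: plane_norm_le => /=; [apply: le_trans r1 eh|apply: le_trans r2 eh].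
(* Here [i] is a coordinate projection and [(m, n)] the corresponding row of the inverse matrix. *)
have main (i : plane K -> K) (m n : K) :
    (forall u v, i (u - v) = i u - i v) ->
    (forall h rho : plane K, i h -
       lin2 m n (lin2 a b h + rho.1, lin2 c d h + rho.2) = - lin2 m n rho) ->
    differentiable (i \o psi) y /\ forall v, 'D_v (i \o psi) y = lin2 m n v.
  move=> iB iE; apply: (@differentiable_approx _ _ _ (lin2 m n)).
    exact: lin2_continuous.
  move=> e e0; pose M := `|m| + `|n| + 1.
  have M0 : 0 < M by rewrite ltr_wpDl ?addr_ge0.
  have e1 : 0 < e / (2 * M) by rewrite divr_gt0 // mulr_gt0.
  apply: filterS (key _ e1) => k [rho [rhok k1 k2]].
  rewrite /= -iB.
  have -> : i (psi (k + y) - psi y) - lin2 m n k = - lin2 m n rho.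
    by rewrite -(iE (psi (k + y) - psi y) rho) -k1 -k2 -surjective_pairing.
  rewrite normrN; apply: le_trans (norm_lin2_le (M := M) _ _ _) _.
  - by rewrite /M -addrA lerDl addr_ge0.
  - by rewrite /M addrAC addrC lerDl addr_ge0.
  apply: le_trans (ler_wpM2l _ rhok) _; first by rewrite mulr_ge0 // ltW.
  by rewrite mulrA mulrCA divff ?mulr1 // mulf_neq0 ?pnatr_eq0 ?gt_eqF.
have [||D1 E1] := main fst (d / J) (- b / J); [by []| |].
  by move=> h rho; rewrite /lin2 /= /J; field.
have [||D2 E2] := main snd (- c / J) (a / J); [by []| |].
  by move=> h rho; rewrite /lin2 /= /J; field.
by split.
Qed.

(* Up to a constant linear change of coordinates, this is the general case. *)
Lemma inverse_function (h1 h2 : plane K -> K) (A : set (plane K)) (c : plane K) :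
  open A -> A c -> smooth_on A h1 -> smooth_on A h2 ->
  d_x h1 c = 1 -> d_y h1 c = 0 -> d_x h2 c = 0 -> d_y h2 c = 1 ->
  let H q : plane K := (h1 q, h2 q) in
  exists (U : set (plane K)) (s : K) (psi : plane K -> plane K),
    [/\ open U, U c, U `<=` A, 0 < s &
    [/\ forall q, U q -> ball (H c) s (H q) /\ psi (H q) = q,
        forall y, ball (H c) s y -> U (psi y) /\ H (psi y) = y &
        smooth_on (ball (H c) s) psi]].
Proof.
move=> oA Ac S1 S2 x1 y1 x2 y2 H.
have [df1 Df1] := S1 1%N; have [df2 Df2] := S2 1%N.
have C_x1 n : class_C n A (d_x h1) by have [_] := S1 n.+1; apply.
have C_y1 n : class_C n A (d_y h1) by have [_] := S1 n.+1; apply.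
have C_x2 n : class_C n A (d_x h2) by have [_] := S2 n.+1; apply.
have C_y2 n : class_C n A (d_y h2) by have [_] := S2 n.+1; apply.
pose J x := d_x h1 x * d_y h2 x - d_y h1 x * d_x h2 x.
have CJ n : class_C n A J.
  apply: (class_C_add oA); first exact: class_C_mul.
  by apply: (class_C_opp oA); exact: class_C_mul.
(* Partial derivatives within 1/4 of the identity give, after the factor 2 of [ball_mean_value], the
   contraction constant 1/2; a Jacobian within 1/2 of 1 is nonzero. *)
have e4 : 0 < 4^-1 :> K by rewrite invr_gt0.
have e2 : 0 < 2^-1 :> K by rewrite invr_gt0.
have nA := open_nbhs_nbhs (conj oA Ac).
have [r /andP[r0 _] rP] := near_ball (filterI nA (filterI
  (filterI (near_norm_le (C_x1 0%N c Ac) e4) (near_norm_le (C_y1 0%N c Ac) e4))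
  (filterI (filterI (near_norm_le (C_x2 0%N c Ac) e4) (near_norm_le (C_y2 0%N c Ac) e4))
     (near_norm_le (CJ 0%N c Ac) e2)))).
have Hr x x' : ball c r x -> ball c r x' ->
    `|H x' - H x - (x' - x)| <= 2^-1 * `|x' - x|.
  move=> xr x'r.
  have E : 2^-1 = 2 * 4^-1 :> K by field.
  apply: plane_norm_le; rewrite E.
    have := @ball_mean_value _ HK h1 c r 1 0 4^-1.
    rewrite /lin2 => M; have := M _ x x' xr x'r; rewrite mul1r mul0r addr0; apply.
    by move=> q /rP[Aq [[+ +] _]]; rewrite x1 y1; split=> //; exact: df1.
  have := @ball_mean_value _ HK h2 c r 0 1 4^-1.
  rewrite /lin2 => M; have := M _ x x' xr x'r; rewrite mul1r mul0r add0r; apply.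
  by move=> q /rP[Aq [_ [[+ +] _]]]; rewrite x2 y2; split=> //; exact: df2.
have J0 x : ball c r x -> J x != 0.
  move=> /rP[_ [_ [_]]]; have -> : J c = 1 by rewrite /J x1 y1 x2 y2 mulr1 mulr0 subr0.
  apply: contraTneq => ->; rewrite sub0r normrN normr1.
  by rewrite lt_geF // invf_lt1 // ltr1n.
(* The radius for which [near_identity_surjective] finds preimages in the ball of radius [r]. *)
have s0 : 0 < r / 2 by rewrite divr_gt0.
have ex y : exists x, ball (H c) (r / 2) y -> ball c r x /\ H x = y.
  have [yr|nyr] := pselect (ball (H c) (r / 2) y); last by exists c.
  have [x xr xE] : exists2 x, ball c r x & H x = y.
    apply: near_identity_surjective Hr _.
    by rewrite mulrC -ltr_pdivlMr // -ballE.
  by exists x.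
pose psi y := projT1 (cid (ex y)).
have psiP y : ball (H c) (r / 2) y -> ball c r (psi y) /\ H (psi y) = y.
  exact: (projT2 (cid (ex y))).
have inj x x' : ball c r x -> ball c r x' -> H x = H x' -> x = x'.
  move=> xr x'r E; have [_] := near_identity_lipschitz (Hr _ _ xr x'r).
  rewrite E subrr normr0 mulr0 normr_le0 subr_eq0 => /eqP ->.
  by [].
have lip y y' : ball (H c) (r / 2) y -> ball (H c) (r / 2) y' ->
    `|psi y - psi y'| <= 2 * `|y - y'|.
  move=> /psiP[yr Ey] /psiP[y'r Ey'].
  by have [_] := near_identity_lipschitz (Hr _ _ y'r yr); rewrite Ey Ey'.
have cr : ball c r c by rewrite ballE subrr normr0.
(* Cutting the ball down to the preimage makes [H] and [psi] inverse bijections. *)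
pose U : set (plane K) := fun x => ball c r x /\ ball (H c) (r / 2) (H x).
have rA : ball c r `<=` A by move=> x /rP[].
have oV : open (ball (H c) (r / 2)) by exact: ball_open.
have obr : open (ball c r) by exact: ball_open.
exists U, (r / 2), psi; split=> //.
- rewrite openE => x [xr Hx]; apply: filterI.
    exact: open_nbhs_nbhs (conj obr xr).
  have cH : H z @[z --> x] --> H x.
    have c1 := differentiable_continuous (df1 x (rA _ xr)).
    have c2 := differentiable_continuous (df2 x (rA _ xr)).
    exact: (cvg_pair (F := nbhs x) c1 c2).
  by apply: cH; exact: open_nbhs_nbhs (conj oV Hx).
- by split=> //; rewrite ballE subrr normr0.
- by move=> x [/rA].
split.
- move=> q [qr Hq]; split=> //; have [pr pE] := psiP _ Hq.
  exact: inj.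
- by move=> y yr; have [pr pE] := psiP _ yr; split=> //; split=> //; rewrite pE.
(* Bootstrapping: the derivatives of [psi] are smooth functions composed with [psi], so class [n] of
   [psi] gives class [n.+1]. *)
suff Sn n : class_C n (ball (H c) (r / 2)) (fst \o psi) /\
            class_C n (ball (H c) (r / 2)) (snd \o psi).
  move=> n; have [C1 C2] := Sn n.
  apply: class_C_ext (class_C_pair oV C1 C2) => // y _ /=.
  by rewrite -surjective_pairing.
have D y : ball (H c) (r / 2) y ->
  [/\ differentiable (fst \o psi) y, differentiable (snd \o psi) y &
    forall v, 'D_v (fst \o psi) y =
        lin2 (d_y h2 (psi y) / J (psi y)) (- d_y h1 (psi y) / J (psi y)) v /\
      'D_v (snd \o psi) y =
        lin2 (- d_x h2 (psi y) / J (psi y)) (d_x h1 (psi y) / J (psi y)) v].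
  move=> yV; have [pr pE] := psiP _ yV.
  apply: (@derive_inverse h1 h2 psi (ball (H c) (r / 2)) y) => //.
  - by move=> z /psiP[].
  - exact/df1/rA.
  - exact/df2/rA.
  - exact: J0.
have sub m (f : plane K -> K) : class_C m A f -> class_C m (ball c r) (fun x => f x / J x).
  move=> Cf; apply: class_C_mul => //; first exact: class_C_subset rA Cf.
  by apply: class_C_inv => //; exact: class_C_subset rA (CJ m).
elim: n => [|n [IH1 IH2]].
  by split=> y /D[d1 d2 _]; exact: differentiable_continuous.
have Cpsi : class_C n (ball (H c) (r / 2)) psi.
  apply: class_C_ext (class_C_pair oV IH1 IH2) => // y _ /=.
  by rewrite -surjective_pairing.
have psir y : ball (H c) (r / 2) y -> ball c r (psi y) by move=> /psiP[].
split; split=> [y /D[]//|v].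
- have CG := class_C_lin2 v obr (sub n _ (C_y2 n)) (sub n _ (class_C_opp oA (C_y1 n))).
  apply: class_C_ext (class_C_comp oV psir Cpsi CG) => // y yV.
  by have [_ _ /(_ v)[-> _]] := D y yV.
- have CG := class_C_lin2 v obr (sub n _ (class_C_opp oA (C_x2 n))) (sub n _ (C_x1 n)).
  apply: class_C_ext (class_C_comp oV psir Cpsi CG) => // y yV.
  by have [_ _ /(_ v)[_ ->]] := D y yV.
Qed.

(** A ball is a union of segments through its centre with real parameters. Connectedness has to be
    supplied for both domains in [parallelizable]. *)
Lemma connected_ball (c : plane K) (r : K) : connected (ball c r).
Proof.
have [r0|/negP nr0] := boolP (0 < r); last first.
  rewrite (_ : ball c r = set0); first exact: connected0.
  apply/seteqP; split=> // x; rewrite ballE => xr; apply: nr0.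
  exact: le_lt_trans xr.
have -> : ball c r = \bigcup_(q in ball c r)
    ((fun t : K => c + t *: (q - c)) @` [set t : K | 0 <= t <= 1]).
  apply/seteqP; split=> [q qr|_ [q qr [t t01 <-]]].
    by exists q => //; exists 1; rewrite /= ?ler01 ?lexx // scale1r subrKC.
  by apply: ball_segment => //; rewrite ballE subrr normr0.
apply: bigcup_connected.
  exists c => q qr; exists 0; rewrite /= ?ler01 ?lexx // scale0r addr0 //.
move=> q qr; apply: connected_continuous_connected.
  exact: (connected_unit_segment HK).
apply: continuous_subspaceT => t.
have dl := is_diffD (is_diff_cst c t) (is_diff_scalel t (q - c)).
by apply: differentiable_continuous; exact: ex_diff.
Qed.

End Picard.

(** * Smooth functions and exponentials *)

Section Smooth.
Context {K : numFieldType}.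
Implicit Types (A : set (plane K)) (f g : plane K -> K) (p v : plane K).

Lemma smooth_differentiable {V W : normedModType K} (A : set V) (f : V -> W) (p : V) :
  smooth_on A f -> A p -> differentiable f p.
Proof. by move=> /(_ 1%N)[df _]; exact: df. Qed.

Lemma smooth_derive {V W : normedModType K} (A : set V) (f : V -> W) (v : V) :
  smooth_on A f -> smooth_on A ('D_v f).
Proof. by move=> Sf n; have [_] := Sf n.+1; apply. Qed.

Lemma smooth_subset {V W : normedModType K} (A B : set V) (f : V -> W) :
  B `<=` A -> smooth_on A f -> smooth_on B f.
Proof. by move=> BA Sf n; apply: class_C_subset (Sf n). Qed.

Lemma smooth_cst {V W : normedModType K} (A : set V) (w : W) : smooth_on A (fun=> w).
Proof. by move=> n; exact: class_C_cst. Qed.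

Lemma smooth_add A f g : open A -> smooth_on A f -> smooth_on A g ->
  smooth_on A (fun p => f p + g p).
Proof. by move=> oA Sf Sg n; apply: class_C_add (Sf n) (Sg n). Qed.

Lemma smooth_opp A f : open A -> smooth_on A f -> smooth_on A (fun p => - f p).
Proof. by move=> oA Sf n; apply: class_C_opp (Sf n). Qed.

Lemma smooth_sub A f g : open A -> smooth_on A f -> smooth_on A g ->
  smooth_on A (fun p => f p - g p).
Proof. by move=> oA Sf Sg; apply: smooth_add => //; exact: smooth_opp. Qed.

Lemma smooth_mul A f g : open A -> smooth_on A f -> smooth_on A g ->
  smooth_on A (fun p => f p * g p).
Proof. by move=> oA Sf Sg n; apply: class_C_mul (Sf n) (Sg n). Qed.

Lemma smooth_inv A f : open A -> (forall p, A p -> f p != 0) ->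
  smooth_on A f -> smooth_on A (fun p => (f p)^-1).
Proof. by move=> oA f0 Sf n; apply: class_C_inv (Sf n). Qed.

Lemma smooth_fst A (w : plane K -> plane K) : open A ->
  smooth_on A w -> smooth_on A (fun p => (w p).1).
Proof.
move=> oA Sw n.
exact: (class_C_lin (l := @fst K K : {linear plane K -> K}) oA fst_continuous (Sw n)).
Qed.

Lemma smooth_snd A (w : plane K -> plane K) : open A ->
  smooth_on A w -> smooth_on A (fun p => (w p).2).
Proof.
move=> oA Sw n.
exact: (class_C_lin (l := @snd K K : {linear plane K -> K}) oA snd_continuous (Sw n)).
Qed.

Lemma smooth_pair A f g : open A -> smooth_on A f -> smooth_on A g ->
  smooth_on A (fun p => (f p, g p) : plane K).
Proof. by move=> oA Sf Sg n; apply: class_C_pair (Sf n) (Sg n). Qed.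

Lemma smooth_comp A (B : set (plane K)) (w : plane K -> plane K) f : open A ->
  (forall p, A p -> B (w p)) -> smooth_on A w -> smooth_on B f ->
  smooth_on A (f \o w).
Proof. by move=> oA AB Sw Sf n; apply: class_C_comp AB (Sw n) (Sf n). Qed.

Lemma derive_add f g p v : differentiable f p -> differentiable g p ->
  'D_v (fun q => f q + g q) p = 'D_v f p + 'D_v g p.
Proof. by move=> df dg; apply: (@deriveD _ _ _ f g); exact: diff_derivable. Qed.

Lemma derive_sub f g p v : differentiable f p -> differentiable g p ->
  'D_v (fun q => f q - g q) p = 'D_v f p - 'D_v g p.
Proof. by move=> df dg; apply: (@deriveB _ _ _ f g); exact: diff_derivable. Qed.

Lemma derive_mul f g p v : differentiable f p -> differentiable g p ->
  'D_v (fun q => f q * g q) p = f p * 'D_v g p + g p * 'D_v f p.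
Proof. by move=> df dg; apply: (@deriveM _ _ f g); exact: diff_derivable. Qed.

Lemma derive_inv f p v : f p != 0 -> differentiable f p ->
  'D_v (fun q => (f q)^-1) p = - 'D_v f p / (f p) ^+ 2.
Proof.
move=> f0 df; rewrite (@deriveV _ _ f p v f0 (diff_derivable (v := v) df)).
by rewrite scaleNr mulNr mulrC.
Qed.

Lemma derive_eq_on A f g p v : open A -> A p -> (forall q, A q -> f q = g q) ->
  'D_v f p = 'D_v g p.
Proof.
move=> oA Ap fg; apply: near_eq_derive.
by apply: filterS (open_nbhs_nbhs (conj oA Ap)).
Qed.

Lemma smooth_primitive A (F w1 w2 : plane K -> K) : open A ->
  (forall q, A q -> [/\ differentiable F q, d_x F q = w1 q & d_y F q = w2 q]) ->
  smooth_on A w1 -> smooth_on A w2 -> smooth_on A F.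
Proof.
move=> oA FP S1 S2 [|n].
  by move=> q /FP[dF _ _]; exact: differentiable_continuous.
split=> [q /FP[]//|v].
apply: class_C_ext (class_C_lin2 v oA (S1 n) (S2 n)) => // q /FP[dF <- <-].
by rewrite derive_lin2.
Qed.

End Smooth.

Section Exponential.
Context {K : numFieldType} (HK : calculus_field K).

(* [s = exp (g - g c)], where [exp] is the first coordinate of the inverse of
   [(x, y) |-> (log x, y)] and [log] is a primitive of [dx / x] near [1]. *)
Lemma exponential_factor (A : set (plane K)) (c : plane K) (g : plane K -> K) :
  open A -> A c -> smooth_on A g ->
  exists2 r : K, 0 < r & exists s : plane K -> K,
    [/\ ball c r `<=` A, smooth_on (ball c r) s, s c = 1 &
      forall q, ball c r q -> s q != 0 /\ forall v, 'D_v s q = s q * 'D_v g q].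
Proof.
move=> oA Ac Sg.
pose A' : set (plane K) := [set q | q.1 != 0].
have oA' : open A'.
  rewrite openE => q q0.
  have e0 : 0 < `|q.1| / 2 by rewrite divr_gt0 // normr_gt0.
  apply: filterS (near_norm_le (@fst_continuous K q) e0) => x.
  apply: contraTneq => ->; rewrite sub0r normrN lt_geF //.
  by rewrite ltr_pdivrMr // ltr_pMr ?ltr1n // normr_gt0.
pose e1 : plane K := (1, 0).
have one : A' e1 by rewrite /A' /= oner_eq0.
have S1 : smooth_on A' (fun q : plane K => q.1^-1).
  apply: smooth_inv => // n.
  exact: (class_C_linear n A' (l := @fst K K : {linear plane K -> K}) fst_continuous).
have S2 : smooth_on A' (snd : plane K -> K).
  move=> n; exact: (class_C_linear n A' (l := @snd K K : {linear plane K -> K}) snd_continuous).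
have S0 : smooth_on A' (fun=> 0 : K) by exact: smooth_cst.
have closed q : A' q -> d_y (fun q : plane K => q.1^-1) q = d_x (fun=> 0) q.
  move=> q0; rewrite [RHS]derive_cst.
  have dfst : differentiable (fst : plane K -> K) q.
    exact: (linear_differentiable _ fst_continuous).
  rewrite [LHS](@derive_inv _ fst) // deriveE //.
  by rewrite (diff_lin (f := (@fst K K : {linear plane K -> K})) _ fst_continuous) /= oppr0 mul0r.
have [r r0 [L LP]] := closed_exact HK oA' one (S1 2%N) (S0 2%N) closed.
have cr : ball e1 r e1 by rewrite ballE subrr normr0.
have ob : open (ball e1 r) by exact: ball_open.
have bA' : ball e1 r `<=` A' by move=> q /LP[].
have SL : smooth_on (ball e1 r) L.
  apply: (@smooth_primitive _ _ _ (fun q : plane K => q.1^-1) (fun=> 0)) => //.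
  - by move=> q /LP[].
  - exact: smooth_subset S1.
  - exact: smooth_subset S0.
have dsnd (q : plane K) : differentiable (snd : plane K -> K) q.
  exact: (linear_differentiable _ snd_continuous).
have Dsnd (q v : plane K) : 'D_v (snd : plane K -> K) q = v.2.
  by rewrite deriveE // (diff_lin (f := (@snd K K : {linear plane K -> K})) _ snd_continuous).
have [_ _ L1 L2] := LP _ cr; rewrite /= invr1 in L1.
have [U [t [psi [oU Uc UA t0 [UP psiP Spsi]]]]] :=
  inverse_function HK ob cr SL (smooth_subset bA' S2) L1 L2 (Dsnd _ _) (Dsnd _ _).
set l := (L e1, _) in UP psiP Spsi.
have lE : l = (L e1, 0) by [].
(* The primitive [L] is known only up to a constant; the shift by [L e1] makes [g = g c] correspond
   to [s = 1]. *)
pose P (q : plane K) : plane K := (g q - g c + L e1, 0).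
have Pl q : P q - l = (g q - g c, 0) by rewrite lE /P; congr pair; rewrite ?subrr ?addrK.
have t2 : 0 < t / 2 by rewrite divr_gt0.
have nA := open_nbhs_nbhs (conj oA Ac).
have [d /andP[d0 _] dP] := near_ball (filterI nA (near_norm_le (Sg 0%N c Ac) t2)).
have dA : ball c d `<=` A by move=> q /dP[].
have PV q : ball c d q -> ball l t (P q).
  move=> /dP[_ gq]; rewrite ballE Pl; apply: (@le_lt_trans _ _ (t / 2)).
    by apply: plane_norm_le; rewrite //= normr0 ltW.
  by rewrite ltr_pdivrMr // ltr_pMr // ltr1n.
have od : open (ball c d) by exact: ball_open.
have SP : smooth_on (ball c d) P.
  apply: smooth_pair; [exact: od| |exact: smooth_cst].
  apply: smooth_add; [exact: od| |exact: smooth_cst].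
  apply: smooth_add; [exact: od| |exact: smooth_cst].
  exact: smooth_subset Sg.
pose s q := (psi (P q)).1.
have oV : open (ball l t) by exact: ball_open.
have Ss : smooth_on (ball c d) s.
  apply: (smooth_comp (f := fun x => (psi x).1) od PV SP).
  exact: smooth_fst.
have Ss2 : smooth_on (ball c d) (fun q => (psi (P q)).2).
  apply: (smooth_comp (f := fun x => (psi x).2) od PV SP).
  exact: smooth_snd.
exists d => //; exists s; split=> //.
  rewrite /s /P subrr add0r -lE.
  by have [_ ->] := UP _ Uc.
move=> q qd; have [Uq Eq] := psiP _ (PV q qd).
have br := UA _ Uq.
have sq0 : s q != 0 by exact: bA'.
split=> // v.
(* On the ball [L (w x) = g x - g c + L e1]; differentiating, with [d L = dx / x], gives
   [ds / s = dg]. *)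
pose w x : plane K := (s x, (psi (P x)).2).
have dw : differentiable w q.
  exact: smooth_differentiable (smooth_pair od Ss Ss2) qd.
have wq : w q = psi (P q) by rewrite /w /s -surjective_pairing.
have [_ dL Lx Ly] := LP _ br.
have dL' : differentiable L (w q) by rewrite wq.
have E : 'D_v (L \o w) q = 'D_v g q.
  transitivity ('D_v (fun x => g x - g c + L e1) q).
    apply: derive_eq_on od qd _ => x xd /=.
    rewrite /w /s -surjective_pairing.
    have [_ Ex] := psiP _ (PV x xd).
    by rewrite -[LHS]/((L (psi (P x)), (psi (P x)).2).1) Ex.
  have dg : differentiable g q by apply: smooth_differentiable Sg _; exact: dA.
  rewrite derive_add; [|exact: differentiableB|exact: differentiable_cst].
  by rewrite derive_sub // !derive_cst subr0 addr0.
rewrite -E (derive_comp v dw dL') (derive_lin2 ('D_v w q) dL') wq Lx Ly /lin2 mul0r addr0.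
have -> : ('D_v w q).1 = 'D_v s q.
  rewrite deriveE // diff_pair /=;
    [|exact: smooth_differentiable Ss qd|exact: smooth_differentiable Ss2 qd].
  by rewrite deriveE //; exact: smooth_differentiable Ss qd.
by rewrite mulrA divff // mul1r.
Qed.

End Exponential.

(** * Webs of parallel lines *)

Section Webs.
Context {K : numFieldType}.
Implicit Types (D U V : set (plane K)) (p q u v : plane K).

(** For [u] nonzero, a linear form whose kernel is the line of [u]; defined through [lin2] to
    inherit linearity and continuity. *)
Definition cross u v : K := lin2 (- u.2) u.1 v.

Lemma crossE u v : cross u v = u.1 * v.2 - u.2 * v.1.
Proof. by rewrite /cross /lin2 mulNr addrC. Qed.

Lemma plane_neq0 u : u != 0 -> u.1 != 0 \/ u.2 != 0.
Proof.
move=> u0; have [u1|] := eqVneq u.1 0; [right|by left].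
by apply: contra_neq u0 => u2; rewrite [u]surjective_pairing u1 u2.
Qed.

Lemma parallel_linesP u p v : u != 0 -> parallel_lines u p v <-> cross u v = 0.
Proof.
move=> u0; rewrite crossE; split=> [[t _ <-]|uv].
  by rewrite /GRing.scale /= /GRing.scale /=; ring.
have [u1|u2] := plane_neq0 u0.
  exists (v.1 / u.1) => //; rewrite [RHS]surjective_pairing; congr pair.
    by rewrite /GRing.scale /= divfK.
  rewrite /GRing.scale /= mulrAC; apply: (canLR (mulfK u1)).
  by apply/eqP; rewrite -subr_eq0 -oppr_eq0 opprB mulrC [v.1 * _]mulrC uv.
exists (v.2 / u.2) => //; rewrite [RHS]surjective_pairing; congr pair.
  rewrite /GRing.scale /= mulrAC; apply: (canLR (mulfK u2)).
  by apply/eqP; rewrite -subr_eq0 mulrC [v.1 * _]mulrC uv.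
by rewrite /GRing.scale /= divfK.
Qed.

Lemma form_line_nontrivial (w : plane K) : exists2 v : plane K, v != 0 &
  w.1 * v.1 + w.2 * v.2 = 0.
Proof.
have [->|w0] := eqVneq w 0.
  exists (1, 0); last by rewrite !mul0r addr0.
  by apply/eqP => -[] /eqP; rewrite oner_eq0.
exists (- w.2, w.1); last by rewrite /=; ring.
have [w1|w2] := plane_neq0 w0; apply/eqP => -[] /eqP; rewrite ?oppr_eq0.
  by move=> _ /eqP; rewrite (negbTE w1).
by rewrite (negbTE w2).
Qed.

(** Where [e] vanishes, [defined_by] would make [X p] the whole plane, which is not the kernel of
    the nonzero local form given by [is_foliation]. *)
Lemma foliation_form_neq0 D (X : tangent_field K) (e : form1 K) p :
  is_foliation D X -> defined_by D X e -> D p -> e p != 0.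
Proof.
move=> XD De Dp; have [U [w [_ Up _ w0 Uw]]] := XD p Dp.
apply/eqP => e0; have /plane_neq0 := w0 p Up.
have ker v : form1_app w p v = 0.
  have : X p v by rewrite (De _ Dp) /= /form1_app e0 !mul0r addr0.
  by rewrite (Uw _ (conj Up Dp)).
have := ker (1, 0); have := ker (0, 1); rewrite /form1_app /= !mulr0 !mulr1 addr0 add0r.
by move=> -> ->; rewrite eqxx => -[].
Qed.

Lemma transversal_wedge_neq0 D (X Y : tangent_field K) (e f : form1 K) p :
  is_foliation D X -> is_foliation D Y -> defined_by D X e -> defined_by D Y f ->
  D p -> X p <> Y p -> wedge e f p != 0.
Proof.
move=> XD YD De Df Dp XY; apply/eqP => ef; apply: XY.
have e0 := foliation_form_neq0 XD De Dp; have f0 := foliation_form_neq0 YD Df Dp.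
rewrite (De _ Dp) (Df _ Dp) /form1_app.
move: ef; rewrite /wedge; move: (e p) (f p) e0 f0 => a b a0 b0 ab.
have sub (x y v : plane K) : x != 0 -> x.1 * y.2 - x.2 * y.1 = 0 ->
    x.1 * v.1 + x.2 * v.2 = 0 -> y.1 * v.1 + y.2 * v.2 = 0.
  move=> x0 xy xv; have [x1|x2] := plane_neq0 x0.
    apply: (mulfI x1); rewrite mulr0.
    have -> : x.1 * (y.1 * v.1 + y.2 * v.2) =
      y.1 * (x.1 * v.1 + x.2 * v.2) + (x.1 * y.2 - x.2 * y.1) * v.2 by ring.
    by rewrite xy xv mulr0 mul0r addr0.
  apply: (mulfI x2); rewrite mulr0.
  have -> : x.2 * (y.1 * v.1 + y.2 * v.2) =
    y.2 * (x.1 * v.1 + x.2 * v.2) - (x.1 * y.2 - x.2 * y.1) * v.1 by ring.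
  by rewrite xy xv mulr0 mul0r subr0.
apply/seteqP; split=> v /=; first exact: sub.
by apply: sub => //; rewrite -[RHS]oppr0 -ab; ring.
Qed.

Lemma is_foliation_subset D U (X : tangent_field K) :
  U `<=` D -> is_foliation D X -> is_foliation U X.
Proof.
move=> UD XD p Up; have [N [w [oN Np Sw w0 Nw]]] := XD p (UD _ Up).
by exists N, w; split=> // q [Nq /UD Dq]; apply: Nw.
Qed.

Lemma same_curve_subset D U (X : tangent_field K) p q :
  U `<=` D -> same_curve U X p q -> same_curve D X p q.
Proof.
move=> UD; elim=> [x y [g [Sg gU gxy]]|x|x y z _ IH1 _ IH2].
- apply: rt_step; exists g; split=> // t /gU[/UD Dg Xg]; by split.
- exact: rt_refl.
- exact: rt_trans IH1 IH2.
Qed.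

(** Covers both shrinking the domain, with [f] the identity, and selecting three of the four
    foliations. *)
Lemma is_web_restrict (m n : nat) D U (X : n.-tuple (tangent_field K))
    (Y : m.-tuple (tangent_field K)) (f : 'I_m -> 'I_n) :
  open U -> connected U -> U `<=` D -> injective f ->
  (forall i, tnth Y i = tnth X (f i)) -> is_web D X -> is_web U Y.
Proof.
move=> oU cU UD fI YX [_ _ fol tr me]; split=> //.
- by move=> i; rewrite YX; apply: is_foliation_subset UD _.
- by move=> i j p ij /UD Dp; rewrite !YX; apply: tr => //; rewrite inj_eq.
- move=> i j p q ij /UD Dp /UD Dq; rewrite !YX => pi pj.
  apply: (me (f i) (f j)) => //; rewrite ?inj_eq //; exact: same_curve_subset UD _.
Qed.

Lemma derive_scale_dir {V W : normedModType K} (f : V -> W) (x v : V) (k : K) :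
  differentiable f x -> 'D_(k *: v) f x = k *: 'D_v f x.
Proof. by move=> df; rewrite !deriveE // linearZ. Qed.

(** [cross u] is a first integral: its derivative along an integral curve vanishes, the velocity
    being parallel to [u]. *)
Lemma same_curve_parallel (HK : calculus_field K) V u p q : u != 0 ->
  same_curve V (parallel_lines u) p q -> cross u p = cross u q.
Proof.
move=> u0; elim=> [x y [g [Sg gV [s [t [s1 t1 <- <-]]]]]|//|x y z _ -> _ ->//].
apply/esym; rewrite -[t in LHS](subrKC s).
apply: (@derive0_const _ HK _ (fun z : K => cross u (g z))) => r r01.
have br := ball_segment s1 t1 r01.
have dg := smooth_differentiable Sg br.
have dc : differentiable (lin2 (- u.2) u.1) (g (s + r *: (t - s))).
  exact: (linear_differentiable _ (@lin2_continuous _ _ _)).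
split; first exact: (differentiable_comp dg dc).
have -> : 'D_(t - s) (fun z : K => cross u (g z)) (s + r *: (t - s)) =
    'D_(t - s) (lin2 (- u.2) u.1 \o g) (s + r *: (t - s)) by [].
rewrite derive_comp // deriveE // (diff_lin _ (@lin2_continuous _ _ _)) /=.
have -> : 'D_(t - s) g (s + r *: (t - s)) = (t - s) *: 'D_1 g (s + r *: (t - s)).
  rewrite -(derive_scale_dir _ _ dg); congr ('D_ _ g _).
  by rewrite [RHS]mulr1.
rewrite linearZ /= -/(cross u _).
by have [_ /(parallel_linesP _ _ u0) ->] := gV _ br; rewrite scaler0.
Qed.

Lemma parallel_lines_web (HK : calculus_field K) (n : nat) V (u : n.-tuple (plane K)) :
  open V -> connected V -> (forall i, tnth u i != 0) ->
  (forall i j, i != j -> cross (tnth u i) (tnth u j) != 0) ->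
  is_web V [tuple of map (@parallel_lines K) u].
Proof.
move=> oV cV u0 uu; split=> //.
- move=> i p Vp; rewrite tnth_map; set x := tnth u i.
  exists setT, (fun=> (- x.2, x.1) : plane K); split=> //.
  + exact: openT.
  + exact: smooth_cst.
  + move=> q _; have [x1|x2] := plane_neq0 (u0 i); apply/eqP => -[] /eqP.
      by move=> _ /eqP; rewrite (negbTE x1).
    by rewrite oppr_eq0 (negbTE x2).
  + move=> q _; apply/seteqP; split=> v /=; rewrite -/(parallel_lines x q v).
      by move/(parallel_linesP _ _ (u0 i)).
    by move=> xv; apply/(parallel_linesP _ _ (u0 i)).
- move=> i j p ij Vp; rewrite !tnth_map => E.
  have : parallel_lines (tnth u i) p (tnth u j).
    by rewrite E; exists 1 => //; rewrite scale1r.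
  by move/(parallel_linesP _ _ (u0 i)) => c0; have := uu i j ij; rewrite c0 eqxx.
- move=> i j p q ij Vp Vq; rewrite !tnth_map.
  move=> /(same_curve_parallel HK (u0 i)) ci /(same_curve_parallel HK (u0 j)) cj.
  have := uu i j ij; move: (tnth u i) (tnth u j) ci cj => x y.
  rewrite !crossE => cx cy xy.
  (* Cramer's rule: a point is determined by its two first integrals. *)
  have E1 (r : plane K) : (x.1 * y.2 - x.2 * y.1) * r.1 =
      y.1 * (x.1 * r.2 - x.2 * r.1) - x.1 * (y.1 * r.2 - y.2 * r.1) by ring.
  have E2 (r : plane K) : (x.1 * y.2 - x.2 * y.1) * r.2 =
      y.2 * (x.1 * r.2 - x.2 * r.1) - x.2 * (y.1 * r.2 - y.2 * r.1) by ring.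
  rewrite [p]surjective_pairing [q]surjective_pairing.
  by congr pair; apply: (mulfI xy); rewrite ?E1 ?E2 cx cy.
Qed.

End Webs.

(** * Flat and parallelizable 3-webs *)

(** Smoothness and the structure equation of [e3 = - (e1 + e2)] follow from those of [e1] and
    [e2]. *)
Record normalized_web {K : numFieldType} (D : set (plane K))
    (X1 X2 X3 : tangent_field K) (e1 e2 e3 th : form1 K) : Prop := {
  nw_smooth1 : smooth_on D e1;
  nw_smooth2 : smooth_on D e2;
  nw_smooth_th : smooth_on D th;
  nw_defines1 : defined_by D X1 e1;
  nw_defines2 : defined_by D X2 e2;
  nw_defines3 : defined_by D X3 e3;
  nw_sum : forall p, D p -> e1 p + e2 p + e3 p = 0;
  nw_d1 : forall p, D p -> d1 e1 p = wedge e1 th p;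
  nw_d2 : forall p, D p -> d1 e2 p = wedge e2 th p;
  nw_wedge : forall p, D p -> wedge e1 e2 p != 0
}.

Section Flat.
Context {K : numFieldType} (HK : calculus_field K).
Implicit Types (D U V : set (plane K)) (p q u v : plane K).

(** With [ds = s th], the differential of [s e] is [s (th /\ e) + s (e /\ th) = 0], so [s e] has a
    local primitive. *)
Lemma scaled_form_primitive D (e th : form1 K) (s : plane K -> K) p (r : K) :
  0 < r -> ball p r `<=` D -> smooth_on D e -> smooth_on (ball p r) s ->
  (forall q, ball p r q -> d1 e q = wedge e th q) ->
  (forall q, ball p r q -> d_x s q = s q * (th q).1 /\ d_y s q = s q * (th q).2) ->
  exists2 t : K, 0 < t <= r & exists2 F : plane K -> K, smooth_on (ball p t) F &
    forall q, ball p t q -> differentiable F q /\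
      forall v, 'D_v F q = s q * form1_app e q v.
Proof.
move=> r0 rD Se Ss de ds.
have ob : open (ball p r) by exact: ball_open.
have pp : ball p r p by rewrite ballE subrr normr0.
have Se1 : smooth_on (ball p r) (fun q => (e q).1).
  by apply: smooth_fst => //; exact: smooth_subset Se.
have Se2 : smooth_on (ball p r) (fun q => (e q).2).
  by apply: smooth_snd => //; exact: smooth_subset Se.
have S1 := smooth_mul ob Ss Se1; have S2 := smooth_mul ob Ss Se2.
have closed q : ball p r q ->
    d_y (fun q => s q * (e q).1) q = d_x (fun q => s q * (e q).2) q.
  move=> qr; have [sx sy] := ds q qr; have := de q qr.
  have dsq := smooth_differentiable Ss qr.
  have E1 := derive_mul (0, 1) dsq (smooth_differentiable Se1 qr).
  have E2 := derive_mul (1, 0) dsq (smooth_differentiable Se2 qr).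
  rewrite /d_y E1 /d_x E2 -/(d_x s q) -/(d_y s q) sx sy /d1 /wedge /d_x /d_y.
  move: ('D_(0, 1) _ q) ('D_(1, 0) _ q) => a b E.
  have -> : b = a + ((e q).1 * (th q).2 - (e q).2 * (th q).1) by rewrite -E addrC subrK.
  ring.
have [t t0 [F FP]] := closed_exact HK ob pp (S1 2%N) (S2 2%N) closed.
(* A radius below both [t] and [r]. *)
exists (t * r / (t + r)); first apply/andP; first split.
- by rewrite divr_gt0 ?mulr_gt0 ?addr_gt0.
- by rewrite ler_pdivrMr ?addr_gt0 // mulrC ler_pM2l // lerDl ltW.
have tt : ball p (t * r / (t + r)) `<=` ball p t.
  apply: le_ball; rewrite ler_pdivrMr ?addr_gt0 // ler_pM2l // lerDr ltW //.
have tr : ball p t `<=` ball p r by move=> q /FP[].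
exists F.
  apply: smooth_subset tt _.
  have obt : open (ball p t) by exact: ball_open.
  apply: (smooth_primitive obt _ (smooth_subset tr S1) (smooth_subset tr S2)) => q qt.
  by have [] := FP q qt.
move=> q /tt qt; have [_ dF Fx Fy] := FP q qt; split=> // v.
by rewrite derive_lin2 // Fx Fy /lin2 /form1_app mulrDr !mulrA.
Qed.

Lemma flat_parallelizable D (X1 X2 X3 : tangent_field K) (e1 e2 e3 th : form1 K) :
  is_web D [tuple X1; X2; X3] -> normalized_web D X1 X2 X3 e1 e2 e3 th ->
  (forall p, D p -> d1 th p = 0) -> parallelizable D [tuple X1; X2; X3].
Proof.
move=> web [Se1 Se2 Sth De1 De2 De3 sum de1 de2 ind] flat p Dp.
have oD := web_open web.
have Sth1 := smooth_fst oD Sth; have Sth2 := smooth_snd oD Sth.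
have closed q : D q -> d_y (fun q => (th q).1) q = d_x (fun q => (th q).2) q.
  by move=> /flat /eqP; rewrite /d1 subr_eq0 => /eqP ->.
have [r r0 [g gP]] := closed_exact HK oD Dp (Sth1 2%N) (Sth2 2%N) closed.
have rD : ball p r `<=` D by move=> q /gP[].
have obr : open (ball p r) by exact: ball_open.
have pr : ball p r p by rewrite ballE subrr normr0.
have Sg : smooth_on (ball p r) g.
  apply: (smooth_primitive obr _ (smooth_subset rD Sth1) (smooth_subset rD Sth2)).
  by move=> q /gP[].
have [r' r'0 [s [r'r Ss sp sP]]] := exponential_factor HK obr pr Sg.
have r'D : ball p r' `<=` D by move=> q /r'r /rD.
have ds q : ball p r' q -> d_x s q = s q * (th q).1 /\ d_y s q = s q * (th q).2.
  move=> qr; have [_ Ds] := sP q qr; have [_ _ gx gy] := gP _ (r'r _ qr).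
  by rewrite /d_x /d_y !Ds -gx -gy.
have [t1 /andP[t10 t1r] [F1 SF1 F1P]] := scaled_form_primitive r'0 r'D Se1 Ss
  (fun q qr => de1 q (r'D q qr)) ds.
have [t2 /andP[t20 t2r] [F2 SF2 F2P]] := scaled_form_primitive r'0 r'D Se2 Ss
  (fun q qr => de2 q (r'D q qr)) ds.
pose B := ball p t1 `&` ball p t2.
have oB : open B by apply: openI; exact: ball_open.
have Bp : B p by split; rewrite ballE subrr normr0.
have B1 : B `<=` ball p t1 by move=> q [].
have B2 : B `<=` ball p t2 by move=> q [].
have Br' : B `<=` ball p r' by move=> q [q1 _]; apply: le_ball q1.
set a := (e1 p).1; set b := (e1 p).2; set c := (e2 p).1; set d := (e2 p).2.
have J0 : a * d - b * c != 0 by exact: ind.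
set J := a * d - b * c in J0.
(* The inverse of the matrix with rows [e1 p] and [e2 p], applied to [(F1, F2)]: since [s p = 1],
   the differential at [p] is the identity, as [inverse_function] requires. *)
pose h1 q := (d / J) * F1 q - (b / J) * F2 q.
pose h2 q := (a / J) * F2 q - (c / J) * F1 q.
have SB1 := smooth_subset B1 SF1; have SB2 := smooth_subset B2 SF2.
have Sc (k : K) (f : plane K -> K) : smooth_on B f -> smooth_on B (fun q => k * f q).
  by move=> Sf; apply: smooth_mul => //; exact: smooth_cst.
have S1 : smooth_on B h1 by apply: smooth_sub => //; exact: Sc.
have S2 : smooth_on B h2 by apply: smooth_sub => //; exact: Sc.
have Dc (k l : K) (f f' : plane K -> K) q v : differentiable f q -> differentiable f' q ->
    'D_v (fun q => k * f q - l * f' q) q = k * 'D_v f q - l * 'D_v f' q.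
  move=> df df'; rewrite derive_sub; [|exact: differentiableM..].
  rewrite !derive_mul //; try exact: differentiable_cst.
  by rewrite !derive_cst !mulr0 !addr0.
have Dh1 q v : B q -> 'D_v h1 q =
    s q * ((d / J) * form1_app e1 q v - (b / J) * form1_app e2 q v).
  move=> [q1 q2]; have [d1 D1] := F1P q q1; have [d2 D2] := F2P q q2.
  by rewrite [LHS]Dc // D1 D2; ring.
have Dh2 q v : B q -> 'D_v h2 q =
    s q * ((a / J) * form1_app e2 q v - (c / J) * form1_app e1 q v).
  move=> [q1 q2]; have [d1 D1] := F1P q q1; have [d2 D2] := F2P q q2.
  by rewrite [LHS]Dc // D1 D2; ring.
have [||||U [t [psi [oU Up UB t0 [UP psiP Spsi]]]]] :=
  @inverse_function _ HK h1 h2 B p oB Bp S1 S2.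
- by rewrite /d_x Dh1 // sp mul1r /form1_app /= -/a -/b -/c -/d /J; field; exact: J0.
- by rewrite /d_y Dh1 // sp mul1r /form1_app /= -/a -/b -/c -/d /J; field; exact: J0.
- by rewrite /d_x Dh2 // sp mul1r /form1_app /= -/a -/b -/c -/d /J; field; exact: J0.
- by rewrite /d_y Dh2 // sp mul1r /form1_app /= -/a -/b -/c -/d /J; field; exact: J0.
pose H q : plane K := (h1 q, h2 q).
have UD : U `<=` D by move=> q /UB/Br'/r'D.
have UH q v : U q -> 'd H q v = ('D_v h1 q, 'D_v h2 q) :> plane K.
  move=> /UB Bq; have d1 := smooth_differentiable S1 Bq.
  have d2 := smooth_differentiable S2 Bq.
  by rewrite diff_pair //= !deriveE.
(* Turns a covector into a direction spanning its kernel. In the chart, the constant form [e p]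
   pulls back to [s e], so its lines correspond to the leaves of [e]. *)
pose rot (x : plane K) : plane K := (- x.2, x.1).
have cross_rot (x y : plane K) : cross (rot x) y = - (x.1 * y.1 + x.2 * y.2).
  by rewrite crossE /rot /=; ring.
have rot0 x : x != 0 -> rot x != 0.
  by move=> /plane_neq0[x1|x2]; apply/eqP => -[] /eqP; rewrite oppr_eq0 ?(negbTE x2) // =>
    _ /eqP; rewrite (negbTE x1).
have equiv (X : tangent_field K) (e : form1 K) q v : defined_by D X e -> e p != 0 -> U q ->
    (e p).1 * 'D_v h1 q + (e p).2 * 'D_v h2 q = s q * form1_app e q v ->
    X q v <-> parallel_lines (rot (e p)) (H q) ('d H q v).
  move=> De e0 Uq E.
  have s0 : s q != 0 by have [] := sP _ (Br' _ (UB _ Uq)).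
  rewrite (De _ (UD _ Uq)); apply: (iff_trans _ (iff_sym (parallel_linesP _ _ (rot0 _ e0)))).
  rewrite UH // cross_rot /= E; split=> [->|/eqP]; first by rewrite mulr0 oppr0.
  by rewrite oppr_eq0 mulf_eq0 (negbTE s0) => /eqP.
have f0 i := web_foliation web i.
have fol1 : is_foliation D X1 by have := f0 (@Ordinal 3 0 isT).
have fol2 : is_foliation D X2 by have := f0 (@Ordinal 3 1 isT).
have fol3 : is_foliation D X3 by have := f0 (@Ordinal 3 2 isT).
have n1 := foliation_form_neq0 fol1 De1 Dp.
have n2 := foliation_form_neq0 fol2 De2 Dp.
have n3 := foliation_form_neq0 fol3 De3 Dp.
have e3E q : D q -> e3 q = - (e1 q + e2 q).
  by move=> /sum /eqP; rewrite addrC addr_eq0 => /eqP.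
have E1 q v : U q -> (e1 p).1 * 'D_v h1 q + (e1 p).2 * 'D_v h2 q = s q * form1_app e1 q v.
  move=> /UB Bq; rewrite Dh1 // Dh2 // -/a -/b.
  by move: (form1_app e1 q v) (form1_app e2 q v) => x y; rewrite /J; field; exact: J0.
have E2 q v : U q -> (e2 p).1 * 'D_v h1 q + (e2 p).2 * 'D_v h2 q = s q * form1_app e2 q v.
  move=> /UB Bq; rewrite Dh1 // Dh2 // -/c -/d.
  by move: (form1_app e1 q v) (form1_app e2 q v) => x y; rewrite /J; field; exact: J0.
have E3 q v : U q -> (e3 p).1 * 'D_v h1 q + (e3 p).2 * 'D_v h2 q = s q * form1_app e3 q v.
  move=> Uq; have := E1 q v Uq; have := E2 q v Uq.
  rewrite /form1_app e3E // (e3E q) /=; last exact: UD.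
  move: ('D_v h1 q) ('D_v h2 q) => x y E2' E1'.
  transitivity (- ((e1 p).1 * x + (e1 p).2 * y + ((e2 p).1 * x + (e2 p).2 * y))); first by ring.
  by rewrite E1' E2'; ring.
pose u := [tuple rot (e1 p); rot (e2 p); rot (e3 p)].
have cU : connected U.
  have -> : U = psi @` ball (H p) t.
    apply/seteqP; split=> [q Uq|_ [y yt <-]]; last by have [] := psiP y yt.
    by have [Hq qE] := UP q Uq; exists (H q).
  apply: connected_continuous_connected; first exact: connected_ball.
  apply: continuous_in_subspaceT => y; rewrite inE => yt.
  exact: Spsi 0%N y yt.
exists U, (ball (H p) t), u; split=> //.
- exact: (@is_web_restrict _ _ _ _ _ _ _ id oU cU UD).
- apply: (parallel_lines_web HK); [exact: ball_open|exact: connected_ball| |].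
    by case=> [[|[|[|//]]] i3]; rewrite (tnth_nth 0) /=; apply: rot0.
  have cr (x y : plane K) : cross (rot x) (rot y) = x.1 * y.2 - x.2 * y.1.
    by rewrite cross_rot /rot /=; ring.
  have J' : (e1 p).1 * (e2 p).2 - (e1 p).2 * (e2 p).1 != 0 by exact: J0.
  have J'' : - ((e1 p).1 * (e2 p).2 - (e1 p).2 * (e2 p).1) != 0 by rewrite oppr_eq0.
  (* Because [e3 = - (e1 + e2)], every one of these determinants is plus or minus [J]. *)
  case=> [[|[|[|//]]] i3] [[|[|[|//]]] j3] //= ij; rewrite !(tnth_nth 0) /= cr ?e3E //=;
    first [by apply: contra_neq J' => <-; ring | by apply: contra_neq J'' => <-; ring].
exists H.
  exists psi; split=> //.
  - by apply: smooth_pair => //; exact: smooth_subset UB _.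
  - by move=> q /UP[].
  - by move=> y /psiP[].
  - by split=> [q|y]; rewrite inE; [case/UP|case/psiP].
case=> [[|[|[|//]]] i3] q v Uq; rewrite tnth_map !(tnth_nth 0) /=.
- by apply: equiv => //; exact: E1.
- by apply: equiv => //; exact: E2.
- by apply: equiv => //; exact: E3.
Qed.

(** For [u = 0] the tangent space would be the zero vector alone, whereas the kernel of a form on
    the plane contains a nonzero vector. *)
Lemma foliation_parallel_neq0 V u p :
  is_foliation V (parallel_lines u) -> V p -> u != 0.
Proof.
move=> fol Vp; have [N [w [_ Np _ w0 Nw]]] := fol p Vp.
have [v v0 wv] := form_line_nontrivial (w p).
apply: contra_neq v0 => u0.
have : parallel_lines u p v by rewrite (Nw p (conj Np Vp)).
by move=> [k _ <-]; rewrite u0 scaler0.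
Qed.

Lemma cross_parallel_neq0 u v p : u != 0 -> v != 0 ->
  parallel_lines u p <> parallel_lines v p -> cross u v != 0.
Proof.
move=> u0 v0 uv; apply/eqP => c0; apply: uv.
have sub (x y z : plane K) : x != 0 -> y != 0 -> cross x y = 0 ->
    parallel_lines x p z -> parallel_lines y p z.
  move=> x0 y0 /(parallel_linesP p y x0)[k _ yE] /(parallel_linesP p z x0) xz.
  by apply/(parallel_linesP p z y0); rewrite -yE; move: xz; rewrite !crossE /= => xz;
    rewrite /GRing.scale /= /GRing.scale /= -!mulrA -mulrBr xz mulr0.
apply/seteqP; split=> z; apply: sub => //.
by move: c0; rewrite !crossE => c0; rewrite -[RHS]oppr0 -c0; ring.
Qed.

(** Since [s e = dF] is closed and [d e = e /\ th], symmetry of second derivatives reads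
    [(ds - s th) /\ e = 0]. *)
Lemma factor_differential U (F s : plane K -> K) (e th : form1 K) q :
  open U -> U q -> smooth_on U F -> smooth_on U s -> smooth_on U e ->
  (forall x, U x -> d_x F x = s x * (e x).1 /\ d_y F x = s x * (e x).2) ->
  d1 e q = wedge e th q ->
  (d_x s q - s q * (th q).1) * (e q).2 - (d_y s q - s q * (th q).2) * (e q).1 = 0.
Proof.
move=> oU Uq SF Ss Se Fe.
have Se1 := smooth_fst oU Se; have Se2 := smooth_snd oU Se.
have dsq := smooth_differentiable Ss Uq.
have := Schwarz HK ((1, 0) : plane K) ((0, 1) : plane K) oU Uq (SF 2%N).
have -> : 'D_(1, 0) ('D_(0, 1) F) q = 'D_(1, 0) (fun x => s x * (e x).2) q.
  by apply: derive_eq_on oU Uq _ => x /Fe[].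
have -> : 'D_(0, 1) ('D_(1, 0) F) q = 'D_(0, 1) (fun x => s x * (e x).1) q.
  by apply: derive_eq_on oU Uq _ => x /Fe[].
have d1q := smooth_differentiable Se1 Uq; have d2q := smooth_differentiable Se2 Uq.
rewrite (derive_mul _ dsq d2q) (derive_mul _ dsq d1q) /d1 /wedge /d_x /d_y.
move: ('D_(1, 0) (fun x => (e x).2) q) ('D_(0, 1) (fun x => (e x).1) q) => a b.
move: ('D_(1, 0) s q) ('D_(0, 1) s q) => sx sy.
move=> E1 E2; have aE : a = b + ((e q).1 * (th q).2 - (e q).2 * (th q).1).
  by rewrite -E2 addrC subrK.
rewrite aE in E1.
have <- : (s q * (b + ((e q).1 * (th q).2 - (e q).2 * (th q).1)) + (e q).2 * sx)
  - (s q * b + (e q).1 * sy) = 0 by rewrite E1 subrr.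
ring.
Qed.

(** Differentiating [ds = s th] gives [0 = s (th /\ th) + s d th = s d th]. As [s] has to be nonzero
    only at [p], the lemma also serves for covariant derivatives with zeros elsewhere. *)
Lemma integrating_factor_closed U (s : plane K -> K) (th : form1 K) p :
  open U -> U p -> smooth_on U s -> smooth_on U th ->
  (forall q, U q -> d_x s q = s q * (th q).1 /\ d_y s q = s q * (th q).2) ->
  s p != 0 -> d1 th p = 0.
Proof.
move=> oU Up Ss Sth ds s0.
have dsp := smooth_differentiable Ss Up.
have dt1 := smooth_differentiable (smooth_fst oU Sth) Up.
have dt2 := smooth_differentiable (smooth_snd oU Sth) Up.
have sx : 'D_(1, 0) s p = s p * (th p).1 := (ds p Up).1.
have sy : 'D_(0, 1) s p = s p * (th p).2 := (ds p Up).2.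
have := Schwarz HK ((1, 0) : plane K) ((0, 1) : plane K) oU Up (Ss 2%N).
have -> : 'D_(1, 0) ('D_(0, 1) s) p = 'D_(1, 0) (fun x => s x * (th x).2) p.
  by apply: derive_eq_on oU Up _ => x /ds[].
have -> : 'D_(0, 1) ('D_(1, 0) s) p = 'D_(0, 1) (fun x => s x * (th x).1) p.
  by apply: derive_eq_on oU Up _ => x /ds[].
rewrite (derive_mul _ dsp dt2) (derive_mul _ dsp dt1) sx sy => E.
apply: (mulfI s0); rewrite mulr0 /d1 /d_x /d_y mulrBr.
move: ('D_(1, 0) _ p) ('D_(0, 1) _ p) E => a b E.
have -> : s p * a = s p * b + (th p).1 * (s p * (th p).2) - (th p).2 * (s p * (th p).1).
  by rewrite -E addrK.
by ring.
Qed.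

Lemma linear_pair_eq0 (x y : plane K) (a b : K) : x.1 * y.2 - x.2 * y.1 != 0 ->
  a * x.2 - b * x.1 = 0 -> a * y.2 - b * y.1 = 0 -> a = 0 /\ b = 0.
Proof.
move=> J0 A1 A2; split; apply: (mulIf J0); rewrite mul0r.
  transitivity (x.1 * (a * y.2 - b * y.1) - y.1 * (a * x.2 - b * x.1)); first by ring.
  by rewrite A1 A2 !mulr0 subrr.
transitivity (x.2 * (a * y.2 - b * y.1) - y.2 * (a * x.2 - b * x.1)); first by ring.
by rewrite A1 A2 !mulr0 subrr.
Qed.

Lemma parallelizable_flat D (X1 X2 X3 : tangent_field K) (e1 e2 e3 th : form1 K) p :
  normalized_web D X1 X2 X3 e1 e2 e3 th ->
  parallelizable D [tuple X1; X2; X3] -> D p -> d1 th p = 0.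
Proof.
move=> [Se1 Se2 Sth De1 De2 De3 sum de1 de2 ind] par Dp.
have [U [V [u [Up UD webU webV [phi [psi [Sphi _ phiUV _ _]] phiP]]]]] := par p Dp.
have oU := web_open webU.
have Vphi := phiUV p Up.
set u1 := tnth u (@Ordinal 3 0 isT); set u2 := tnth u (@Ordinal 3 1 isT).
set u3 := tnth u (@Ordinal 3 2 isT).
have un0 i : tnth u i != 0.
  by have := web_foliation webV i; rewrite tnth_map => /foliation_parallel_neq0; apply; exact: Vphi.
have uc i j : i != j -> cross (tnth u i) (tnth u j) != 0.
  move=> ij; apply: (@cross_parallel_neq0 _ _ (phi p)) => //.
  by have := web_transversal webV ij Vphi; rewrite !tnth_map.
have k1 : cross u2 u3 != 0 by exact: uc.
have k2 : cross u3 u1 != 0 by exact: uc.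
have k3 : cross u1 u2 != 0 by exact: uc.
pose f (k : K) (x : plane K) q := k * cross x (phi q).
have Sf k x : smooth_on U (f k x).
  apply: smooth_mul => //; first exact: smooth_cst.
  have -> : (fun q => cross x (phi q)) = (fun q => (- x.2) * (phi q).1 + x.1 * (phi q).2) by [].
  by apply: smooth_add => //; apply: smooth_mul => //; try exact: smooth_cst;
    [exact: smooth_fst|exact: smooth_snd].
have Df k x q v : U q -> 'D_v (f k x) q = k * cross x ('d phi q v).
  move=> Uq; have dphi := smooth_differentiable Sphi Uq.
  have dl := linear_differentiable (phi q) (@lin2_continuous K (- x.2) x.1).
  have dc : differentiable (fun q => cross x (phi q)) q := differentiable_comp dphi dl.
  rewrite [LHS](derive_mul v (differentiable_cst k q) dc).
  rewrite derive_cst mulr0 addr0; congr (_ * _).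
  rewrite -[LHS]/('D_v (lin2 (- x.2) x.1 \o phi) q) derive_comp // deriveE //.
  by rewrite (diff_lin _ (@lin2_continuous _ _ _)) /= deriveE.
have ker (X : tangent_field K) (e : form1 K) k i q v : defined_by D X e ->
    tnth [tuple X1; X2; X3] i = X -> k != 0 -> U q ->
    form1_app e q v = 0 <-> 'D_v (f k (tnth u i)) q = 0.
  move=> De XE k0 Uq; rewrite Df //.
  have := phiP i q v Uq; rewrite XE tnth_map (De _ (UD _ Uq)) => E.
  apply: (iff_trans E); apply: (iff_trans (parallel_linesP _ _ (un0 i))).
  split=> [->|/eqP]; first by rewrite mulr0.
  by rewrite mulf_eq0 (negbTE k0) => /eqP.
(* Equal kernels make the forms proportional: evaluate [dF] on the vector that spans the kernel of
   [e]. *)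
have prop (e : form1 K) (F : plane K -> K) q :
    differentiable F q -> (forall v, form1_app e q v = 0 -> 'D_v F q = 0) ->
    d_x F q * (e q).2 - d_y F q * (e q).1 = 0.
  move=> dF /(_ (- (e q).2, (e q).1)); rewrite derive_lin2 // /lin2 /form1_app /= => E.
  rewrite -[RHS]oppr0 -E; first by ring.
  by ring.
(* These weights are the coefficients of the linear relation between three vectors of a plane, so
   that [F1 + F2 + F3 = 0], matching [e1 + e2 + e3 = 0]. *)
set F1 := f (cross u2 u3) u1; set F2 := f (cross u3 u1) u2; set F3 := f (cross u1 u2) u3.
have ker1 q v : U q -> form1_app e1 q v = 0 <-> 'D_v F1 q = 0.
  by apply: (ker X1 e1 (cross u2 u3) (@Ordinal 3 0 isT) q v De1 _ k1).
have ker2 q v : U q -> form1_app e2 q v = 0 <-> 'D_v F2 q = 0.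
  by apply: (ker X2 e2 (cross u3 u1) (@Ordinal 3 1 isT) q v De2 _ k2).
have ker3 q v : U q -> form1_app e3 q v = 0 <-> 'D_v F3 q = 0.
  by apply: (ker X3 e3 (cross u1 u2) (@Ordinal 3 2 isT) q v De3 _ k3).
have Fsum q v : U q -> 'D_v F1 q + 'D_v F2 q + 'D_v F3 q = 0.
  move=> Uq; rewrite /F1 /F2 /F3 !Df // !crossE; move: ('d phi q v) => x; ring.
pose w q := (e1 q).1 * (e2 q).2 - (e1 q).2 * (e2 q).1.
have w0 q : U q -> w q != 0 by move=> /UD; exact: ind.
have Se1U := smooth_subset UD Se1; have Se2U := smooth_subset UD Se2.
have SthU := smooth_subset UD Sth.
have S11 := smooth_fst oU Se1U; have S12 := smooth_snd oU Se1U.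
have S21 := smooth_fst oU Se2U; have S22 := smooth_snd oU Se2U.
have SF1 : smooth_on U F1 by exact: Sf.
have SF2 : smooth_on U F2 by exact: Sf.
have Sw : smooth_on U w by apply: smooth_sub => //; exact: smooth_mul.
(* The solution of [dF1 = s e1], isolated by taking the wedge with [e2]; in this form its smoothness
   is visible. *)
pose s q := (d_x F1 q * (e2 q).2 - d_y F1 q * (e2 q).1) * (w q)^-1.
have SF1x : smooth_on U (d_x F1) by exact: smooth_derive.
have SF1y : smooth_on U (d_y F1) by exact: smooth_derive.
have Ss : smooth_on U s.
  apply: smooth_mul => //; last exact: smooth_inv.
  by apply: smooth_sub => //; exact: smooth_mul.
have dF q : U q -> (d_x F1 q = s q * (e1 q).1 /\ d_y F1 q = s q * (e1 q).2) /\
    (d_x F2 q = s q * (e2 q).1 /\ d_y F2 q = s q * (e2 q).2).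
  move=> Uq.
  have P1 := prop e1 F1 q (smooth_differentiable SF1 Uq) (fun v => (ker1 q v Uq).1).
  have P2 := prop e2 F2 q (smooth_differentiable SF2 Uq) (fun v => (ker2 q v Uq).1).
  have P3 := prop e3 F3 q (smooth_differentiable (Sf _ _) Uq) (fun v => (ker3 q v Uq).1).
  have Gx : d_x F3 q = - (d_x F1 q + d_x F2 q).
    by apply/eqP; rewrite -addr_eq0 addrC; apply/eqP; exact: Fsum.
  have Gy : d_y F3 q = - (d_y F1 q + d_y F2 q).
    by apply/eqP; rewrite -addr_eq0 addrC; apply/eqP; exact: Fsum.
  have e3E : e3 q = - (e1 q + e2 q).
    by have /eqP := sum _ (UD _ Uq); rewrite addrC addr_eq0 => /eqP.
  rewrite Gx Gy e3E /= in P3.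
  have := w0 q Uq; rewrite /s /w.
  move: (d_x F1 q) (d_y F1 q) (d_x F2 q) (d_y F2 q) (e1 q) (e2 q) P1 P2 P3.
  move=> a b c d x y P1 P2 P3 J0.
  (* The third foliation forces a common factor: expanding [dF3 /\ e3 = 0] by the two sum relations
     leaves [dF1 /\ e2 + dF2 /\ e1 = 0]. *)
  have E : a * y.2 - b * y.1 = d * x.1 - c * x.2.
    apply/eqP; rewrite -subr_eq0; apply/eqP.
    rewrite -[RHS](subr0 0) -{1}P3 -{1}(addr0 0) -{1}P1 -P2.
    ring.
  split; split; apply: (mulIf J0); rewrite mulrAC divfK //.
  - by apply/eqP; rewrite -subr_eq0; apply/eqP; rewrite -[RHS](mulr0 (- y.1)) -P1; ring.
  - by apply/eqP; rewrite -subr_eq0; apply/eqP; rewrite -[RHS](mulr0 (- y.2)) -P1; ring.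
  - by rewrite E; apply/eqP; rewrite -subr_eq0; apply/eqP; rewrite -[RHS](mulr0 (x.1)) -P2; ring.
  - by rewrite E; apply/eqP; rewrite -subr_eq0; apply/eqP; rewrite -[RHS](mulr0 (x.2)) -P2; ring.
have s0 q : U q -> s q != 0.
  move=> Uq; apply/eqP => sq0; have [[Fx Fy] _] := dF q Uq.
  have e0 v : form1_app e1 q v = 0.
    apply/(ker1 q v Uq); rewrite derive_lin2; last exact: smooth_differentiable SF1 Uq.
    by rewrite Fx Fy sq0 !mul0r /lin2 !mul0r addr0.
  have := w0 q Uq; rewrite /w.
  have := e0 (1, 0); have := e0 (0, 1); rewrite /form1_app /= !mulr0 !mulr1 add0r addr0.
  by move=> -> ->; rewrite !mul0r subrr eqxx.
have ds q : U q -> d_x s q = s q * (th q).1 /\ d_y s q = s q * (th q).2.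
  move=> Uq.
  have A1 := factor_differential oU Uq SF1 Ss Se1U (fun x Ux => (dF x Ux).1) (de1 _ (UD _ Uq)).
  have A2 := factor_differential oU Uq SF2 Ss Se2U (fun x Ux => (dF x Ux).2) (de2 _ (UD _ Uq)).
  have [a0 b0] := linear_pair_eq0 (w0 q Uq) A1 A2.
  by split; apply/eqP; rewrite -subr_eq0; apply/eqP.
exact: integrating_factor_closed oU Up Ss SthU ds (s0 p Up).
Qed.

End Flat.

(** * The subwebs of a 4-web *)

Section Forms.
Context {K : numFieldType}.
Implicit Types (D : set (plane K)) (e f th : form1 K) (k l : plane K -> K).

Lemma smooth_scale_form D k e : open D -> smooth_on D k -> smooth_on D e ->
  smooth_on D (fun q => k q *: e q).
Proof.
move=> oD Sk Se; apply: (smooth_pair oD); apply: smooth_mul => //.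
  exact: smooth_fst.
exact: smooth_snd.
Qed.

Lemma smooth_add_form D e f : open D -> smooth_on D e -> smooth_on D f ->
  smooth_on D (fun q => e q + f q).
Proof.
move=> oD Se Sf; apply: (smooth_pair oD); apply: smooth_add => //;
  by [exact: smooth_fst|exact: smooth_snd].
Qed.

Lemma smooth_div D k l : open D -> (forall q, D q -> l q != 0) ->
  smooth_on D k -> smooth_on D l -> smooth_on D (fun q => k q / l q).
Proof. by move=> oD l0 Sk Sl; apply: smooth_mul => //; exact: smooth_inv. Qed.

Lemma d0_sub D k l p : open D -> D p -> smooth_on D k -> smooth_on D l ->
  d0 (fun q => k q - l q) p = d0 k p - d0 l p.
Proof.
move=> oD Dp Sk Sl; have dk := smooth_differentiable Sk Dp.
have dl := smooth_differentiable Sl Dp.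
by congr pair; exact: derive_sub.
Qed.

Lemma d0_cst (c : K) p : d0 (fun=> c) p = 0.
Proof. by congr pair; exact: derive_cst. Qed.

Lemma d0_div D k l p : open D -> D p -> smooth_on D k -> smooth_on D l -> l p != 0 ->
  d0 (fun q => k q / l q) p = (l p)^-1 *: d0 k p - (k p / l p ^+ 2) *: d0 l p.
Proof.
move=> oD Dp Sk Sl l0; have dk := smooth_differentiable Sk Dp.
have dl := smooth_differentiable Sl Dp.
have dV : differentiable (fun q => (l q)^-1) p by exact: differentiableV.
have E v : 'D_v (fun q => k q / l q) p = (l p)^-1 * 'D_v k p - (k p / l p ^+ 2) * 'D_v l p.
  rewrite (derive_mul v dk dV) (derive_inv v l0 dl).
  by move: ('D_v k p) ('D_v l p) => x y; ring.
by congr pair; exact: E.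
Qed.

Lemma d1_add D e f p : open D -> D p -> smooth_on D e -> smooth_on D f ->
  d1 (fun q => e q + f q) p = d1 e p + d1 f p.
Proof.
move=> oD Dp Se Sf; rewrite /d1 /d_x /d_y.
rewrite (derive_add _ (smooth_differentiable (smooth_fst oD Se) Dp)
                      (smooth_differentiable (smooth_fst oD Sf) Dp)).
rewrite (derive_add _ (smooth_differentiable (smooth_snd oD Se) Dp)
                      (smooth_differentiable (smooth_snd oD Sf) Dp)).
by rewrite opprD addrACA.
Qed.

Lemma d1_scale D k e p : open D -> D p -> smooth_on D k -> smooth_on D e ->
  d1 (fun q => k q *: e q) p = wedge (d0 k) e p + k p * d1 e p.
Proof.
move=> oD Dp Sk Se; rewrite /d1 /d0 /wedge /d_x /d_y /=.
have dk := smooth_differentiable Sk Dp.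
rewrite (derive_mul _ dk (smooth_differentiable (smooth_fst oD Se) Dp)).
rewrite (derive_mul _ dk (smooth_differentiable (smooth_snd oD Se) Dp)).
move: ('D_(1, 0) _ p) ('D_(0, 1) _ p) ('D_(1, 0) _ p) ('D_(0, 1) _ p) => a b c d.
ring.
Qed.

End Forms.

Section FourWeb.
Context {K : numFieldType} (HK : calculus_field K).
Context (D : set (plane K)) (X1 X2 X3 X4 : tangent_field K) (w : web_data K).
Context (web : is_web D [tuple X1; X2; X3; X4]).
Context (data : is_web_data D X1 X2 X3 X4 w).

Let a := binv w.
Let a1 := binv1 w.
Let a2 := binv2 w.

Let oD : open D := web_open web.

Let fol i := web_foliation web i.

Lemma vol_neq0 p : D p -> wedge (om1 w) (om2 w) p != 0.
Proof.
move=> Dp.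
apply: (transversal_wedge_neq0 (fol (@Ordinal 4 0 isT)) (fol (@Ordinal 4 1 isT))
  (om1_defines data) (om2_defines data) Dp).
exact: (web_transversal web (i := @Ordinal 4 0 isT) (j := @Ordinal 4 1 isT)).
Qed.

Let om3E p : D p -> om3 w p = - (om1 w p + om2 w p).
Proof. by move=> /(om_sum data)/eqP; rewrite addrC addr_eq0 => /eqP. Qed.

Let om4E p : D p -> om4 w p = - (a p *: om1 w p + om2 w p).
Proof. by move=> /(om4_eq data) <-; rewrite opprK. Qed.

Let a_neq0 p : D p -> a p != 0. Proof. exact: inv_neq0 data p. Qed.

Let a_neq1 p : D p -> a p != 1. Proof. exact: inv_neq1 data p. Qed.

Let a_sub1 p : D p -> a p - 1 != 0.
Proof. by move=> /a_neq1; rewrite subr_eq0. Qed.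

Let sub1_a p : D p -> 1 - a p != 0.
Proof. by move=> /a_neq1; rewrite subr_eq0 eq_sym. Qed.

Let d0_a p : D p -> d0 a p = a1 p *: om1 w p + a2 p *: om2 w p.
Proof. exact: d_inv data p. Qed.

Let d0_a1 p : D p ->
  d0 a1 p = a1 p *: theta w p + (binv11 w p *: om1 w p + binv12 w p *: om2 w p).
Proof. by move=> /(d_inv1 data) <-; rewrite addrC subrK. Qed.

Let d0_a2 p : D p ->
  d0 a2 p = a2 p *: theta w p + (binv12 w p *: om1 w p + binv22 w p *: om2 w p).
Proof. by move=> /(d_inv2 data) <-; rewrite addrC subrK. Qed.

Let Sa : smooth_on D a := inv_smooth data.
Let Sa1 : smooth_on D a1 := inv1_smooth data.
Let Sa2 : smooth_on D a2 := inv2_smooth data.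
Let S1 : smooth_on D (om1 w) := om1_smooth data.
Let S2 : smooth_on D (om2 w) := om2_smooth data.
Let S3 : smooth_on D (om3 w) := om3_smooth data.
Let Sth : smooth_on D (theta w) := theta_smooth data.
Let Sc (c : K) : smooth_on D (fun=> c) := @smooth_cst _ _ _ D c.

Let defined_by_scale (X : tangent_field K) (e : form1 K) (k : plane K -> K) :
  (forall p, D p -> k p != 0) -> defined_by D X e ->
  defined_by D X (fun q => k q *: e q).
Proof.
move=> k0 De p Dp; rewrite (De p Dp); apply/seteqP; split=> v /=;
  rewrite /form1_app /= /GRing.scale /= -!mulrA -mulrDr; first by move=> ->; rewrite mulr0.
by move=> /eqP; rewrite mulf_eq0 (negbTE (k0 p Dp)) => /eqP.
Qed.

(* The forms of [[124]] are [a om1, om2, om4], those of [[134]] are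
   [(a - 1) om1, - om3, om4], those of [[234]] are [(1 - a) om2, - a om3, om4];
   the correction of [theta] is the only one satisfying [d ei = ei /\ th]. *)
Lemma normalized_subweb (s : subweb) :
  exists (Y1 Y2 Y3 : tangent_field K) (e1 e2 e3 th : form1 K),
    [/\ subweb_foliations X1 X2 X3 X4 s = [tuple Y1; Y2; Y3],
        normalized_web D Y1 Y2 Y3 e1 e2 e3 th &
        forall p, D p -> d1 th p = curvature_form w s p].
Proof.
case: s => /=.
- exists X1, X2, X3, (om1 w), (om2 w), (om3 w), (theta w); split=> //.
    split=> //; [exact: om1_defines data|exact: om2_defines data|
      exact: om3_defines data|exact: om_sum data|exact: d_om1 data|exact: d_om2 data|
      exact: vol_neq0].
  exact: d_theta data.
(* A multiple of [om2] leaves the equation of [om2] intact, and [d (a om1)] fixes the coefficient.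
   The leading [0 -] lets [d0_sub] differentiate it. *)
- pose la q := 0 - a2 q / a q.
  have Sq : smooth_on D (fun q => a2 q / a q) by exact: smooth_div.
  have Sla : smooth_on D la by exact: smooth_sub.
  have Sla2 : smooth_on D (fun q => la q *: om2 w q) by exact: smooth_scale_form.
  exists X1, X2, X4, (fun q => a q *: om1 w q), (om2 w), (om4 w),
    (fun q => theta w q + la q *: om2 w q); split=> //.
    split=> //.
    + exact: smooth_scale_form.
    + exact: smooth_add_form.
    + exact: defined_by_scale (om1_defines data).
    + exact: om2_defines data.
    + exact: om4_defines data.
    + by move=> p Dp; rewrite om4E // subrr.
    + move=> p Dp; rewrite (d1_scale oD Dp) // (d_om1 data Dp) /wedge (d0_a Dp) /la /=.
      have := a_neq0 Dp; rewrite /GRing.scale /=.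
      move: (om1 w p) (om2 w p) (theta w p) => x y t a0; rewrite -/(a p) -/(a1 p) -/(a2 p).
      by field.
    + move=> p Dp; rewrite (d_om2 data Dp) /wedge /la /= /GRing.scale /=; ring.
    + move=> p Dp; have := vol_neq0 Dp; have := a_neq0 Dp.
      rewrite /wedge /= /GRing.scale /= => a0 v0.
      by rewrite -mulrA [_ * (om1 w p).2 * _]mulrAC -!mulrA -mulrBr mulf_neq0 //
        [_ * (om1 w p).2]mulrC.
  move=> p Dp; rewrite (d1_add oD Dp) // (d1_scale oD Dp) //.
  rewrite (d_theta data Dp) (d_om2 data Dp) /wedge (d0_sub oD Dp) // d0_cst.
  rewrite (d0_div oD Dp) //; last exact: a_neq0.
  rewrite (d0_a2 Dp) (d0_a Dp).
  have := a_neq0 Dp; rewrite /la /= /GRing.scale /= -/(a p) -/(a1 p) -/(a2 p).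
  move: (om1 w p) (om2 w p) (theta w p) => x y t a0.
  by field.
(* Likewise a multiple of [om3], with coefficient fixed by [d ((a - 1) om1)]. *)
- pose la q := a2 q / (a q - 1).
  have Sb : smooth_on D (fun q => a q - 1) by exact: smooth_sub.
  have Sla : smooth_on D la by exact: smooth_div.
  have Sla3 : smooth_on D (fun q => la q *: om3 w q) by exact: smooth_scale_form.
  exists X1, X3, X4, (fun q => (a q - 1) *: om1 w q), (fun q => (-1) *: om3 w q),
    (om4 w), (fun q => theta w q + la q *: om3 w q); split=> //.
    split=> //.
    + exact: smooth_scale_form.
    + by apply: smooth_scale_form => //; exact: Sc.
    + exact: smooth_add_form.
    + exact: defined_by_scale (om1_defines data).
    + by apply: defined_by_scale (om3_defines data) => p _; rewrite oppr_eq0 oner_eq0.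
    + exact: om4_defines data.
    + move=> p Dp; rewrite om4E // om3E // scaleN1r opprK scalerBl scale1r.
      by rewrite [_ + (_ + _)]addrA subrK subrr.
    + move=> p Dp; rewrite (d1_scale oD Dp) // (d_om1 data Dp) /wedge (d0_sub oD Dp) //.
      rewrite d0_cst (d0_a Dp) (om3E Dp) /la /=.
      have := a_sub1 Dp; rewrite /GRing.scale /=.
      move: (om1 w p) (om2 w p) (theta w p) => x y t a0.
      by field.
    + move=> p Dp; rewrite (d1_scale oD Dp (Sc (-1)) S3).
      rewrite (d_om3 data Dp) /wedge d0_cst /la /= /GRing.scale /=; ring.
    + move=> p Dp; have := vol_neq0 Dp; have := a_sub1 Dp.
      rewrite /wedge om3E // /= /GRing.scale /= => a0 v0.
      by apply: contra_neq (mulf_neq0 a0 v0) => E; rewrite -[RHS]E; ring.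
  move=> p Dp; rewrite (d1_add oD Dp) // (d1_scale oD Dp) //.
  rewrite (d_theta data Dp) (d_om3 data Dp) /wedge (d0_div oD Dp) //; last exact: a_sub1.
  rewrite (d0_sub oD Dp) // d0_cst (d0_a2 Dp) (d0_a Dp) (om3E Dp).
  have := a_sub1 Dp; have := sub1_a Dp; rewrite /la /= /GRing.scale /= -/(a p) -/(a1 p) -/(a2 p).
  move: (om1 w p) (om2 w p) (theta w p) => x y t a0 a0'.
  by field; rewrite a0 a0'.
(* Both scalings vary here: [d (- a om3)] determines [la], and [d ((1 - a) om2)] determines [mu]. *)
- pose la q := (a1 q - a2 q) / a q; pose mu q := 0 - a1 q / (1 - a q).
  have Sb : smooth_on D (fun q => 1 - a q) by exact: smooth_sub.
  have Sd : smooth_on D (fun q => a1 q - a2 q) by exact: smooth_sub.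
  have Sla : smooth_on D la by exact: smooth_div.
  have Sq : smooth_on D (fun q => a1 q / (1 - a q)) by exact: smooth_div.
  have Smu : smooth_on D mu by exact: smooth_sub.
  have Sla2 : smooth_on D (fun q => la q *: om2 w q) by exact: smooth_scale_form.
  have Smu3 : smooth_on D (fun q => mu q *: om3 w q) by exact: smooth_scale_form.
  have S0a : smooth_on D (fun q => 0 - a q) by exact: smooth_sub.
  exists X2, X3, X4, (fun q => (1 - a q) *: om2 w q), (fun q => (0 - a q) *: om3 w q),
    (om4 w), (fun q => theta w q + (la q *: om2 w q + mu q *: om3 w q)); split=> //.
    split=> //.
    + exact: smooth_scale_form.
    + exact: smooth_scale_form.
    + by apply: smooth_add_form => //; exact: smooth_add_form.
    + exact: defined_by_scale (om2_defines data).
    + apply: defined_by_scale (om3_defines data) => p Dp.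
      by rewrite sub0r oppr_eq0 a_neq0.
    + exact: om4_defines data.
    + move=> p Dp; rewrite om4E // om3E //.
      case: (om1 w p) (om2 w p) => [x1 x2] [y1 y2].
      by congr pair; rewrite /= /GRing.scale /=; ring.
    + move=> p Dp; rewrite (d1_scale oD Dp) // (d_om2 data Dp) /wedge (d0_sub oD Dp) //.
      rewrite d0_cst (d0_a Dp) (om3E Dp) /la /mu /=.
      have := sub1_a Dp; have := a_neq0 Dp; rewrite /GRing.scale /=.
      move: (om1 w p) (om2 w p) (theta w p) => x y t a0 a0'.
      by field; rewrite a0 a0'.
    + move=> p Dp; rewrite (d1_scale oD Dp) // (d_om3 data Dp) /wedge (d0_sub oD Dp) //.
      rewrite d0_cst (d0_a Dp) (om3E Dp) /la /mu /=.
      have := sub1_a Dp; have := a_neq0 Dp; rewrite /GRing.scale /=.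
      move: (om1 w p) (om2 w p) (theta w p) => x y t a0 a0'.
      by field; rewrite a0 a0'.
    + move=> p Dp; have := vol_neq0 Dp; have := sub1_a Dp; have := a_neq0 Dp.
      rewrite /wedge om3E // /= /GRing.scale /= => a0 a0' v0.
      apply: contra_neq (mulf_neq0 (mulf_neq0 a0 a0') v0) => E.
      by rewrite -[RHS]oppr0 -E; ring.
  move=> p Dp; rewrite (d1_add oD Dp) //; last exact: smooth_add_form.
  rewrite (d1_add oD Dp) // (d1_scale oD Dp) // (d1_scale oD Dp) //.
  rewrite (d_theta data Dp) (d_om2 data Dp) (d_om3 data Dp) /wedge.
  rewrite (d0_sub oD Dp (Sc 0) Sq) (d0_div oD Dp Sd Sa (a_neq0 Dp)).
  rewrite (d0_div oD Dp Sa1 Sb (sub1_a Dp)).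
  rewrite (d0_sub oD Dp Sa1 Sa2) (d0_sub oD Dp (Sc 1) Sa) !d0_cst.
  rewrite (d0_a1 Dp) (d0_a2 Dp) (d0_a Dp) (om3E Dp).
  have := a_sub1 Dp; have := sub1_a Dp; have := a_neq0 Dp.
  rewrite /la /mu /= /GRing.scale /= -/(a p) -/(a1 p) -/(a2 p).
  move: (om1 w p) (om2 w p) (theta w p) => x y t a0 a0' a0''.
  by field; rewrite a0 a0' a0''.
Qed.

(** After division by the common volume, [K] cancels from each comparison with [[123]], leaving a
    triangular linear system: [[124]] gives [a12], then [[134]] gives [a22] and [[234]] gives
    [a11]. *)
Lemma second_derivatives_of_equal_forms p : D p ->
  (forall s t, curvature_form w s p = curvature_form w t p) ->
  [/\ binv11 w p = a1 p * ((1 - 2 * a p) * a1 p + a p * a2 p) / (a p - a p ^+ 2),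
      binv12 w p = a1 p * a2 p / a p &
      binv22 w p = a2 p * (a1 p - a p * a2 p) / (a p - a p ^+ 2)].
Proof.
move=> Dp eqf.
have n0 := a_neq0 Dp; have n1 := a_sub1 Dp; have n1' := sub1_a Dp.
have n2 : a p - a p ^+ 2 != 0 by rewrite expr2 -{1}[a p]mulr1 -mulrBr mulf_neq0.
have E12 := mulIf (vol_neq0 Dp) (eqf Sub124 Sub123).
have E13 := mulIf (vol_neq0 Dp) (eqf Sub134 Sub123).
have E23 := mulIf (vol_neq0 Dp) (eqf Sub234 Sub123).
move: E12 E13 E23; rewrite /curvature -/(a p) -/(a1 p) -/(a2 p).
move: (a p) (a1 p) (a2 p) (binv11 w p) (binv12 w p) (binv22 w p) (curv w p) n0 n1 n1' n2.
move=> x x1 x2 x11 x12 x22 k n0 n1 n1' n2 E12 E13 E23.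
have F12 : x12 = x1 * x2 / x.
  apply/eqP; rewrite -subr_eq0; apply/eqP.
  transitivity (- x * (x * (x^-1 * (k - x12 / x + x1 * x2 / x ^+ 2)) - k)).
    by field.
  by rewrite E12 subrr mulr0.
have F22 : x22 = x2 * (x1 - x * x2) / (x - x ^+ 2).
  apply/eqP; rewrite -subr_eq0; apply/eqP.
  transitivity (- (1 - x) * ((x - 1) * ((x - 1)^-1 *
      (k + x2 * (x1 - x2) / (1 - x) ^+ 2 + (x12 - x22) / (1 - x))) - k)).
    by rewrite F12; field; rewrite n0 n1 n1' n2.
  by rewrite E13 subrr mulr0.
have F11 : x11 = x1 * ((1 - 2 * x) * x1 + x * x2) / (x - x ^+ 2).
  apply/eqP; rewrite -subr_eq0; apply/eqP.
  transitivity (x * (1 - x) * (x * (x - 1) * ((x * (x - 1))^-1 *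
    (k + (2 * x - 1) * x1 * (x1 - x2) / (x ^+ 2 * (1 - x) ^+ 2)
       + (x11 - x12) / (x * (1 - x)))) - k)).
    by rewrite F12; field; rewrite n0 n1 n1' n2.
  by rewrite E23 subrr mulr0.
by split.
Qed.

(** With [s] whichever of [a1], [a2] is nonzero at [p], [integrating_factor_closed] gives
    [d (theta + rho) = 0]. Inserting the second derivatives, [d rho] cancels and [d theta]
    remains. *)
Lemma curv_eq0 : nonconstant_invariant D w ->
  (forall (s t : subweb) p, D p -> curvature_form w s p = curvature_form w t p) ->
  forall p, D p -> curv w p = 0.
Proof.
move=> nonconst eqf p Dp.
have second q (Dq : D q) := second_derivatives_of_equal_forms Dq (fun s t => eqf s t q Dq).
pose la q := a1 q / a q; pose nu q := a2 q / a q.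
pose mu q := (a2 q - a1 q) / (1 - a q); pose mu' q := (a1 q - a2 q) / (1 - a q).
have Sb : smooth_on D (fun q => 1 - a q) by exact: smooth_sub.
have Sd : smooth_on D (fun q => a2 q - a1 q) by exact: smooth_sub.
have Sd' : smooth_on D (fun q => a1 q - a2 q) by exact: smooth_sub.
have Sla : smooth_on D la by exact: smooth_div.
have Snu : smooth_on D nu by exact: smooth_div.
have Smu : smooth_on D mu by exact: smooth_div.
have Smu' : smooth_on D mu' by exact: smooth_div.
have Sf (k : plane K -> K) (e : form1 K) :
    smooth_on D k -> smooth_on D e -> smooth_on D (fun q => k q *: e q).
  exact: smooth_scale_form.
have Sg (e f : form1 K) : smooth_on D e -> smooth_on D f -> smooth_on D (fun q => e q + f q).
  exact: smooth_add_form.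
have a_sqr q : D q -> a q - a q ^+ 2 != 0.
  by move=> Dq; rewrite expr2 -{1}[a q]mulr1 -mulrBr mulf_neq0 ?a_neq0 ?sub1_a.
have n0 := a_neq0 Dp; have n1 := sub1_a Dp; have n2 := a_sqr p Dp.
apply: (mulIf (vol_neq0 Dp)); rewrite mul0r.
have [a1p|a1p] := eqVneq (a1 p) 0; last first.
  (* The quotients [a11 / a1] and [a12 / a1] after cancelling [a1], the first split into partial
     fractions; thus [rho = da / a + mu om1]. *)
  pose rho q := la q *: om1 w q + (mu q *: om1 w q + nu q *: om2 w q).
  have Smn := Sg _ _ (Sf _ _ Smu S1) (Sf _ _ Snu S2).
  have Srho := Sg _ _ (Sf _ _ Sla S1) Smn.
  have <- : d1 (fun q => theta w q + rho q) p = 0.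
    apply: (integrating_factor_closed HK oD Dp Sa1 _ _ a1p); first exact: Sg.
    move=> q Dq; have := d0_a1 Dq; have [-> -> _] := second q Dq; rewrite /rho /la /mu /nu.
    have := a_neq0 Dq; have := sub1_a Dq; have := a_sqr q Dq.
    move=> m2 m1 m0 E; rewrite -[d_x a1 q]/((d0 a1 q).1) -[d_y a1 q]/((d0 a1 q).2) E.
    by split; rewrite /= /GRing.scale /=; field; rewrite m0 m1 m2.
  rewrite (d1_add oD Dp Sth Srho) (d1_add oD Dp (Sf _ _ Sla S1) Smn).
  rewrite (d1_add oD Dp (Sf _ _ Smu S1) (Sf _ _ Snu S2)).
  rewrite (d1_scale oD Dp Sla S1) (d1_scale oD Dp Smu S1) (d1_scale oD Dp Snu S2).
  rewrite (d_theta data Dp) (d_om1 data Dp) (d_om2 data Dp) /wedge.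
  rewrite (d0_div oD Dp Sa1 Sa n0) (d0_div oD Dp Sa2 Sa n0) (d0_div oD Dp Sd Sb n1).
  rewrite (d0_sub oD Dp Sa2 Sa1) (d0_sub oD Dp (Sc 1) Sa) d0_cst.
  rewrite (d0_a1 Dp) (d0_a2 Dp) (d0_a Dp).
  have [-> -> ->] := second p Dp; rewrite /la /mu /nu /= /GRing.scale /=.
  move: (om1 w p) (om2 w p) (theta w p) => x y t.
  by field; rewrite n0 n1 n2.
have a2p : a2 p != 0 by apply/eqP => a2p; exact: nonconst p Dp (conj a1p a2p).
(* The same with [a2]: [a12 / a2 = a1 / a] and [a22 / a2 = a1 / a + (a1 - a2) / (1 - a)]. *)
pose rho q := la q *: om1 w q + (la q *: om2 w q + mu' q *: om2 w q).
have Smn := Sg _ _ (Sf _ _ Sla S2) (Sf _ _ Smu' S2).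
have Srho := Sg _ _ (Sf _ _ Sla S1) Smn.
have <- : d1 (fun q => theta w q + rho q) p = 0.
  apply: (integrating_factor_closed HK oD Dp Sa2 _ _ a2p); first exact: Sg.
  move=> q Dq; have := d0_a2 Dq; have [_ -> ->] := second q Dq; rewrite /rho /la /mu'.
  have := a_neq0 Dq; have := sub1_a Dq; have := a_sqr q Dq.
  move=> m2 m1 m0 E; rewrite -[d_x a2 q]/((d0 a2 q).1) -[d_y a2 q]/((d0 a2 q).2) E.
  by split; rewrite /= /GRing.scale /=; field; rewrite m0 m1 m2.
rewrite (d1_add oD Dp Sth Srho) (d1_add oD Dp (Sf _ _ Sla S1) Smn).
rewrite (d1_add oD Dp (Sf _ _ Sla S2) (Sf _ _ Smu' S2)).
rewrite (d1_scale oD Dp Sla S1) (d1_scale oD Dp Sla S2) (d1_scale oD Dp Smu' S2).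
rewrite (d_theta data Dp) (d_om1 data Dp) (d_om2 data Dp) /wedge.
rewrite (d0_div oD Dp Sa1 Sa n0) (d0_div oD Dp Sd' Sb n1).
rewrite (d0_sub oD Dp Sa1 Sa2) (d0_sub oD Dp (Sc 1) Sa) d0_cst.
rewrite (d0_a1 Dp) (d0_a2 Dp) (d0_a Dp).
have [-> -> ->] := second p Dp; rewrite /la /mu' /= /GRing.scale /=.
move: (om1 w p) (om2 w p) (theta w p) => x y t.
by field; rewrite n0 n1 n2.
Qed.

Lemma subweb_is_web (s : subweb) : is_web D (subweb_foliations X1 X2 X3 X4 s).
Proof.
have cD := web_connected web.
have restrict (Y : 3.-tuple (tangent_field K)) (f : 'I_3 -> 'I_4) : injective f ->
    (forall i, tnth Y i = tnth [tuple X1; X2; X3; X4] (f i)) -> is_web D Y.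
  by move=> fI Yf; exact: is_web_restrict oD cD (@subset_refl _ D) fI Yf web.
(* Each subweb omits one foliation [j], so the selection is the injection [lift j]. *)
have [j jE] : exists j : 'I_4, forall i, tnth (subweb_foliations X1 X2 X3 X4 s) i =
    tnth [tuple X1; X2; X3; X4] (lift j i).
  case: s; [exists (@Ordinal 4 3 isT)|exists (@Ordinal 4 2 isT)|
            exists (@Ordinal 4 1 isT)|exists (@Ordinal 4 0 isT)];
    by case=> [[|[|[|//]]] i3]; rewrite !(tnth_nth X1).
exact: restrict (@lift_inj _ j) jE.
Qed.

Lemma subweb_parallelizable_iff (s : subweb) :
  parallelizable D (subweb_foliations X1 X2 X3 X4 s) <->
  forall p, D p -> curvature_form w s p = 0.
Proof.
have [Y1 [Y2 [Y3 [e1 [e2 [e3 [th [YE nw dth]]]]]]]] := normalized_subweb s.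
have webY := subweb_is_web s; rewrite YE in webY *.
split=> [par p Dp|flat]; first by rewrite -dth //; exact: parallelizable_flat nw par Dp.
by apply: flat_parallelizable nw _ => // p Dp; rewrite dth // flat.
Qed.

Lemma curvature_eq0 (s : subweb) p : D p ->
  curvature_form w s p = 0 -> curvature w s p = 0.
Proof.
move=> Dp; have v0 := vol_neq0 Dp; have n0 := a_neq0 Dp; have n1 := a_sub1 Dp.
case: s; rewrite /curvature_form => /eqP; rewrite mulf_eq0 (negbTE v0) orbF.
- by move/eqP.
- by rewrite mulf_eq0 (negbTE n0) => /eqP.
- by rewrite mulf_eq0 (negbTE n1) => /eqP.
- by rewrite mulf_eq0 mulf_eq0 (negbTE n0) (negbTE n1) => /eqP.
Qed.

Lemma equal_curvature_forms_eq0 : nonconstant_invariant D w ->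
  (forall (s t : subweb) p, D p -> curvature_form w s p = curvature_form w t p) ->
  forall (s : subweb) p, D p -> curvature_form w s p = 0.
Proof.
move=> nonconst eqf s p Dp; rewrite (eqf s Sub123 p Dp).
by rewrite /curvature_form /= curv_eq0 // mul0r.
Qed.

End FourWeb.

Theorem theorem8 (R : realType) (c : category)
    (D : set (plane (scalars R c)))
    (X1 X2 X3 X4 : tangent_field (scalars R c))
    (w : web_data (scalars R c)) :
  is_web D [tuple X1; X2; X3; X4] ->
  is_web_data D X1 X2 X3 X4 w ->
  nonconstant_invariant D w ->
  let forms_equal := forall (s t : subweb) p, D p ->
    curvature_form w s p = curvature_form w t p in
  let all_parallelizable := forall s : subweb,
    parallelizable D (subweb_foliations X1 X2 X3 X4 s) in
  let curvatures_vanish := forall (s : subweb) p, D p ->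
    curvature w s p = 0 /\ curvature_form w s p = 0 in
  let second_derivatives := forall p, D p ->
    let a := binv w p in
    let a1 := binv1 w p in
    let a2 := binv2 w p in
    [/\ binv11 w p = a1 * ((1 - 2 * a) * a1 + a * a2) / (a - a ^+ 2),
        binv12 w p = a1 * a2 / a &
        binv22 w p = a2 * (a1 - a * a2) / (a - a ^+ 2)] in
  (forms_equal <-> all_parallelizable) /\
  (all_parallelizable <-> (curvatures_vanish /\ second_derivatives)).
Proof.
move=> web data nonconst; have HK := scalars_calculus_field R c.
have par s := subweb_parallelizable_iff HK web data s.
move=> forms_equal all_par vanish second.
(* Vanishing forms are equal, so the algebra of equal forms also yields the second derivatives in
   the parallelizable case. *)
have par_eq : all_par -> forms_equal.
  by move=> Hpar s t p Dp; rewrite ((par s).1 (Hpar s)) // ((par t).1 (Hpar t)).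
split; split=> //.
- by move=> eqf s; apply/par => p Dp;
    exact: (equal_curvature_forms_eq0 HK web data nonconst eqf).
- move=> Hpar; split=> [s p Dp|p Dp].
    have f0 := (par s).1 (Hpar s) p Dp; split=> //.
    exact: (curvature_eq0 web data Dp f0).
  apply: (second_derivatives_of_equal_forms web data Dp) => s t.
  exact: par_eq Hpar s t p Dp.
- by move=> [van _] s; apply/par => p Dp; have [] := van s p Dp.
Qed.
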